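(* The monoid $M=\mathrm{Emb}(\mathbb{Q},betw)$ has automatic homeomorphicity: for every countable set $\Omega$ and every monoid isomorphism $\theta$ from $M$ onto a closed submonoid of the full transformation monoid $Tr(\Omega)$, $\theta$ is a homeomorphism.
   Context: On $\mathbb{Q}$ the betweenness relation is $betw(x,y,z)$ iff $x\le y\le z$ or $z\le y\le x$. $\mathrm{Emb}(\mathbb{Q},betw)$ is the monoid (under composition) of injective maps $f:\mathbb{Q}\to\mathbb{Q}$ preserving $betw$ (equivalently, injective maps preserving strict betweenness $x<y<z \vee z<y<x$). For a countable set $X$, $Tr(X)$ is the monoid of all maps $X\to X$. Transformation monoids carry the topology of pointwise convergence, whose basic open sets are $\{f : f(b_k)=c_k \text{ for } k=1,\dots,n\}$ for finite tuples $b_k,c_k$ of points. *)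

(* Defs.v *)
From HB Require Import structures.
From mathcomp Require Import all_boot all_order all_algebra.
From mathcomp Require Import all_classical topology.

Set Implicit Arguments.
Unset Strict Implicit.
Unset Printing Implicit Defensive.

Import Order.TTheory.
Local Open Scope classical_set_scope.

(* The alias Tr keeps the monoid structure off the arrow type. *)
Definition Tr (X : choiceType) : Type := {ptws X -> discrete_topology X}.

HB.instance Definition _ (X : choiceType) :=
  Topological.copy (Tr X) {ptws X -> discrete_topology X}.

Section TrMonoid.
Variable X : choiceType.

Definition Tr_mul (f g : Tr X) : Tr X := f \o g.
Definition Tr_one : Tr X := idfun.

Lemma Tr_mulA : associative Tr_mul. Proof. by []. Qed.
Lemma Tr_mul1 : left_id Tr_one Tr_mul. Proof. by []. Qed.
Lemma Tr_mulr1 : right_id Tr_one Tr_mul. Proof. by []. Qed.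

HB.instance Definition _ := isMonoid.Build (Tr X) Tr_mulA Tr_mul1 Tr_mulr1.
End TrMonoid.

(* The base of the topology of pointwise convergence given by the sets
   {f | f b_k = c_k, k = 1, ..., n}; a tuple of pairs (b_k, c_k) is coded
   by the sequence bc. *)
Definition Tr_basic (X : choiceType) (bc : seq (X * X)) : set (Tr X) :=
  [set f : Tr X | forall p, p \in bc -> f p.1 = p.2].

Lemma Tr_basis (X : choiceType) : basis (range (@Tr_basic X)).
Proof.
split.
  move=> _ [bc _ <-]; elim: bc => [|[b c] bc IH].
    by rewrite (_ : Tr_basic _ = setT) ?predeqE//; exact: openT.
  have -> : Tr_basic ((b, c) :: bc) =
      (fun f : Tr X => f b) @^-1` [set c] `&` Tr_basic bc.
    rewrite predeqE => f; split.
      move=> H; split; first exact: (H (b, c) (mem_head _ _)).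
      by move=> p pbc; apply: H; rewrite in_cons pbc orbT.
    by move=> [/= fb H] p; rewrite in_cons => /orP[/eqP->|/H].
  apply: openI IH; apply: open_comp; last exact: discrete_open.
  by move=> f _; exact: (@proj_continuous X (fun=> discrete_topology X) b f).
move=> f.
have FF : Filter (filter_from [set U | range (@Tr_basic X) U /\ U f] id).
  apply: filter_from_filter.
    by exists setT; split => //; exists [::]; rewrite // predeqE.
  move=> _ _ [[bc _ <-] bcf] [[bd _ <-] bdf]; exists (Tr_basic (bc ++ bd)).
    split; first by exists (bc ++ bd).
    by move=> p; rewrite mem_cat => /orP[/bcf|/bdf].
  by move=> g H; split=> p pb; apply: H; rewrite mem_cat pb ?orbT.
apply/cvg_sup => x A; rewrite /nbhs/= => -[_ [[B oB <-]] Bf BA].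
exists (Tr_basic [:: (x, f x)]).
  by split; [exists [:: (x, f x)]|move=> p; rewrite inE => /eqP->].
move=> g /(_ (x, f x) (mem_head _ _))/= gx; apply: BA => /=.
by rewrite /= gx.
Qed.

Record submonoid (G : monoidType) := Submonoid {
  submonoid_set :> set G;
  submonoid_closed : monoid_closed (fun x => x \in submonoid_set)
}.

HB.instance Definition _ (G : monoidType) (N : submonoid G) :=
  SubChoice.copy (set_type N) {x : G | x \in (N : set G)}.
HB.instance Definition _ (G : monoidType) (N : submonoid G) :=
  SubChoice_isSubMonoid.Build G _ (set_type N) (submonoid_closed N).

Definition homeomorphism (S T : topologicalType) (f : S -> T) : Prop :=
  continuous f /\
  exists g : T -> S, [/\ cancel f g, cancel g f & continuous g].

Definition monoid_isomorphism (G H : monoidType) (f : G -> H) : Prop :=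
  monoid_morphism f /\ bijective f.

(* A submonoid of Tr X, seen as a type, carries the subspace topology that the
   library puts on set_type, and composition as its multiplication. *)
Definition automatic_homeomorphicity (X : choiceType)
    (M : submonoid (Tr X)) : Prop :=
  forall (Omega : countType) (N : submonoid (Tr Omega)),
    closed (N : set (Tr Omega)) ->
  forall theta : M -> N,
    monoid_isomorphism theta -> homeomorphism theta.

Definition betw (x y z : rat) : bool := (x <= y <= z)%O || (z <= y <= x)%O.

Definition emb_betw : set (Tr rat) :=
  [set f : Tr rat | injective f /\
    forall x y z : rat, betw x y z -> betw (f x) (f y) (f z)].

Lemma emb_betw_closed : monoid_closed (fun f => f \in emb_betw).
Proof.
split; first by rewrite inE; split.
move=> f g; rewrite !inE => -[finj fb] [ginj gb]; split.
  exact: inj_comp finj ginj.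
by move=> x y z /gb/fb.
Qed.

Definition Emb_betw : submonoid (Tr rat) := Submonoid emb_betw_closed.

(* Main.v *)
(* Call a subgroup of the group G of order automorphisms of the rationals small
   if its index is countable. The core is that a small subgroup contains the
   pointwise stabilizer of a finite set. Given an isomorphism theta, this applies
   to the stabilizers of points of Omega, so each theta(g)(w), for g in G, depends
   only on the restriction of g to a finite set F(w). For an increasing embedding
   s, the values theta(g)(w) for g agreeing with s on F(w) therefore define a
   point t of Tr(Omega), which lies in the closed set N, hence t = theta(s') for
   some s'. The inverse of theta is continuous for algebraic reasons, namely that
   s(b) = c can be expressed by inequations between words in s, and this forces
   s' = s because G is dense among the increasing embeddings. Hence theta is
   continuous at s; decreasing embeddings reduce to increasing ones by composing
   with x |-> - x. *)

Require Import Defs.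
From HB Require Import structures.
From mathcomp Require Import all_boot all_order all_algebra.
From mathcomp Require Import all_classical topology.
From mathcomp Require Import zify ring lra.

Set Implicit Arguments.
Unset Strict Implicit.
Unset Printing Implicit Defensive.

Import Order.TTheory GRing.Theory Num.Theory.
Local Open Scope classical_set_scope.
Local Open Scope ring_scope.

(** * The group of order automorphisms of the rationals *)

Record aut := Aut {
  aut_fun :> rat -> rat;
  aut_inv : rat -> rat;
  aut_funK : cancel aut_fun aut_inv;
  aut_invK : cancel aut_inv aut_fun;
  aut_mono : {homo aut_fun : x y / x < y}
}.

Lemma autP (f g : aut) : f =1 g -> f = g.
Proof.
case: f => f f' fK f'K fm; case: g => g g' gK g'K gm /= fg.
have {}fg : f = g by apply/funext.
rewrite {}fg in fK f'K fm *.
have fg' : f' = g' by apply/funext => x; rewrite -{1}(g'K x) fK.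
rewrite {}fg' in fK f'K *.
by congr Aut; exact: Prop_irrelevance.
Qed.

HB.instance Definition _ := gen_eqMixin aut.
HB.instance Definition _ := gen_choiceMixin aut.

Lemma aut_lt (f : aut) (x y : rat) : (f x < f y) = (x < y).
Proof.
case: (ltgtP x y) => [xy|yx|->]; last by rewrite ltxx.
- exact: aut_mono.
- by apply/negbTE; rewrite -leNgt ltW//; exact: aut_mono.
Qed.

Definition aut_one : aut := @Aut id id (fun=> erefl) (fun=> erefl) (fun _ _ => id).

Definition aut_mul (f g : aut) : aut :=
  @Aut (f \o g) (aut_inv g \o aut_inv f)
    (can_comp (aut_funK f) (aut_funK g)) (can_comp (aut_invK g) (aut_invK f))
    (fun x y xy => aut_mono f (aut_mono g xy)).

Lemma aut_inv_mono (f : aut) : {homo aut_inv f : x y / x < y}.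
Proof. by move=> x y xy; rewrite -(aut_lt f) !aut_invK. Qed.

Definition aut_opp (f : aut) : aut :=
  @Aut (aut_inv f) f (aut_invK f) (aut_funK f) (@aut_inv_mono f).

Fact aut_mulA : associative aut_mul. Proof. by move=> f g h; exact: autP. Qed.
Fact aut_mul1 : left_id aut_one aut_mul. Proof. by move=> f; exact: autP. Qed.
Fact aut_mulr1 : right_id aut_one aut_mul. Proof. by move=> f; exact: autP. Qed.
Fact aut_mulV : left_inverse aut_one aut_opp aut_mul.
Proof. by move=> f; apply: autP => x; exact: aut_funK. Qed.
Fact aut_mulrV : right_inverse aut_one aut_opp aut_mul.
Proof. by move=> f; apply: autP => x; exact: aut_invK. Qed.

HB.instance Definition _ :=
  isGroup.Build aut aut_mulA aut_mul1 aut_mulr1 aut_mulV aut_mulrV.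

Lemma autM (f g : aut) (x : rat) : (f * g)%g x = f (g x). Proof. by []. Qed.
Lemma autK (f : aut) (x : rat) : (f^-1)%g (f x) = x. Proof. exact: aut_funK. Qed.
Lemma autKV (f : aut) (x : rat) : f ((f^-1)%g x) = x. Proof. exact: aut_invK. Qed.

Lemma aut_le (f : aut) (x y : rat) : (f x <= f y) = (x <= y).
Proof. by rewrite !leNgt aut_lt. Qed.

Lemma aut_inj (f : aut) : injective f.
Proof. exact: can_inj (autK f). Qed.

Lemma autV_eq (f : aut) (x y : rat) : f x = y -> (f^-1)%g y = x.
Proof. by move=> <-; rewrite autK. Qed.

Lemma autV_fix (f : aut) (x : rat) : f x = x -> (f^-1)%g x = x.
Proof. exact: autV_eq. Qed.

(** Preimages are picked by choice; strict monotonicity on a linear order makes this choice a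
    two-sided inverse. *)
Lemma aut_exists (f : rat -> rat) : {homo f : x y / x < y} ->
  (forall y, exists x, f x = y) -> exists g : aut, g =1 f.
Proof.
move=> fm fs; pose f' y := xget 0 [set x | f x = y].
have f'K : cancel f' f.
  by move=> y; rewrite /f'; have [x fx] := fs y; case: xgetP => [_ ->//|/(_ x)].
have fK : cancel f f'.
  move=> x; have := f'K (f x); case: (ltgtP (f' (f x)) x) => // /fm.
    by move=> + fe; rewrite fe ltxx.
  by move=> + fe; rewrite fe ltxx.
by exists (Aut fK f'K fm).
Qed.

(* The hypothesis says that [S] is separated from its complement by fixed
   points of [g]. *)
Lemma aut_split (g : aut) (S : set rat) :
  (forall x y, S x -> ~ S y ->
    exists2 p, g p = p & (x <= p <= y) || (y <= p <= x)) ->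
  exists h k : aut, [/\ g = (h * k)%g,
    forall x, S x -> h x = g x /\ k x = x &
    forall x, ~ S x -> h x = x /\ k x = g x].
Proof.
move=> sep.
(* A fixed point [p] between [x] and [g x] also bounds [g x] from the other side by monotonicity, so
   [g x = p = g p]. Hence [g] preserves both [S] and its complement. *)
have fixp p x : g p = p -> (x <= p <= g x) || (g x <= p <= x) -> g x = x.
  move=> gp /orP[/andP[xp pg]|/andP[pg xp]].
    have : g x = p by apply/le_anti; rewrite pg andbT -[X in _ <= X]gp aut_le.
    by rewrite -{1}gp => /aut_inj ->.
  have : g x = p by apply/le_anti; rewrite pg/= -[X in X <= _]gp aut_le.
  by rewrite -{1}gp => /aut_inj ->.
have Sg x : S x -> S (g x).
  move=> Sx; apply: contrapT => nS; have [p gp /(fixp _ _ gp) gx] := sep _ _ Sx nS.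
  by rewrite gx in nS.
have nSg x : ~ S x -> ~ S (g x).
  move=> nS Sx; have [p gp] := sep _ _ Sx nS.
  by rewrite orbC => /(fixp _ _ gp) gx; rewrite gx in Sx.
pose f x := if `[<S x>] then g x else x.
have fS x : S x -> f x = g x by move=> Sx; rewrite /f asboolT.
have fN x : ~ S x -> f x = x by move=> Sx; rewrite /f asboolF.
have [||h hf] := @aut_exists f.
- move=> x y xy; have [Sx|Sx] := pselect (S x); have [Sy|Sy] := pselect (S y).
  + by rewrite !fS// aut_lt.
  + rewrite fS// fN// lt_neqAle; apply/andP; split.
      by apply/eqP => e; apply: Sy; rewrite -e; exact: Sg.
    have [p gp /orP[/andP[xp py]|/andP[yp px]]] := sep _ _ Sx Sy.
      by rewrite (le_trans _ py)// -gp aut_le.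
    by have := lt_le_trans xy yp; rewrite ltNge px.
  + rewrite fN// (fS y)// lt_neqAle; apply/andP; split.
      by apply/eqP => e; apply: Sx; rewrite e; exact: Sg.
    have [p gp /orP[/andP[yp px]|/andP[xp py]]] := sep _ _ Sy Sx.
      by have := lt_le_trans xy yp; rewrite ltNge px.
    by rewrite (le_trans xp)// -{1}gp aut_le.
  + by rewrite !fN.
- move=> y; have [Sy|Sy] := pselect (S y); last by exists y; rewrite fN.
  exists ((g^-1)%g y); rewrite fS ?autKV//; apply: contrapT => /nSg.
  by rewrite autKV.
have hS x : S x -> h x = g x by move=> Sx; rewrite hf fS.
have hN x : ~ S x -> h x = x by move=> Sx; rewrite hf fN.
exists h, (h^-1 * g)%g; split.
- by rewrite mulgA mulgV mul1g.
- by move=> x Sx; rewrite autM -hS// autK.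
- by move=> x Sx; rewrite autM hN//; split=> //; apply: autV_fix; rewrite hN//; exact: nSg.
Qed.

Lemma aut_glue (f g : aut) (c : rat) : f c = g c ->
  exists h : aut, (forall x, x <= c -> h x = f x) /\ (forall x, c <= x -> h x = g x).
Proof.
move=> fg; pose u x := if x <= c then f x else g x.
have [||h hu] := @aut_exists u.
- move=> x y xy; rewrite /u; case: (leP x c) => xc; case: (leP y c) => yc.
  + by rewrite aut_lt.
  + by apply: (@le_lt_trans _ _ (f c)); rewrite ?aut_le// fg aut_lt.
  + by have := lt_trans xc xy; rewrite ltNge yc.
  + by rewrite aut_lt.
- move=> y; rewrite /u; case: (leP y (f c)) => yc.
    by exists ((f^-1)%g y); rewrite -(aut_le f) autKV yc.
  exists ((g^-1)%g y).
  have -> : ((g^-1)%g y <= c) = false by rewrite -(aut_le g) autKV -fg leNgt yc.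
  exact: autKV.
exists h; split=> x xc; rewrite hu /u ?xc//.
by case: ifP => // xc'; have -> : x = c by apply/le_anti; rewrite xc xc'.
Qed.

Lemma aut_affine (a b c d : rat) : a < b -> c < d ->
  exists g : aut, g a = c /\ g b = d.
Proof.
move=> ab cd; pose s := (d - c) / (b - a).
have s0 : 0 < s by rewrite divr_gt0 ?subr_gt0.
have [||g gE] := @aut_exists (fun x => c + (x - a) * s).
- by move=> x y xy; rewrite ltrD2l ltr_pM2r// ltrD2r.
- move=> y; exists (a + (y - c) / s).
  by rewrite addrAC subrr add0r divfK ?lt0r_neq0// addrC subrK.
exists g; rewrite !gE subrr mul0r addr0; split=> //.
by rewrite /s mulrC divfK ?subr_eq0 ?gt_eqF// addrC subrK.
Qed.

(** Induction from the right end: an affine map takes care of the first gap and is glued at [y] to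
    an automorphism handling the remaining points. *)
Lemma aut_extend_sorted (f : rat -> rat) (x : rat) (l : seq rat) :
  path <%R x l -> {in x :: l &, {homo f : y z / y < z}} ->
  exists g : aut, {in x :: l, g =1 f}.
Proof.
elim: l x => [x _ _|y l IH x /= /andP[xy yl] fm].
  have [||g gE] := @aut_exists (fun z => z + (f x - x)).
  - by move=> u v uv; rewrite ltrD2r.
  - by move=> u; exists (u - (f x - x)); rewrite subrK.
  by exists g => z; rewrite inE => /eqP->; rewrite gE addrC subrK.
have [g gE] : exists g : aut, {in y :: l, g =1 f}.
  by apply: IH => // u v ul vl; apply: fm; rewrite inE ?ul ?vl orbT.
have [a [ax ay]] : exists a : aut, a x = f x /\ a y = f y.
  by apply: aut_affine => //; apply: fm; rewrite // !inE eqxx ?orbT.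
have [|h [h1 h2]] := @aut_glue a g y; first by rewrite ay gE ?mem_head.
exists h => z; rewrite inE => /orP[/eqP->|zl]; first by rewrite h1 ?ltW.
rewrite h2 ?gE//; move: zl; rewrite inE => /orP[/eqP->//|zl].
by rewrite ltW//; move: yl; rewrite lt_path_sortedE => /andP[/allP/(_ _ zl)].
Qed.

Lemma aut_extend (f : rat -> rat) (E : seq rat) :
  {in E &, {homo f : y z / y < z}} -> exists g : aut, {in E, g =1 f}.
Proof.
move=> fm; have fm' : {in sort <=%R (undup E) &, {homo f : y z / y < z}}.
  by move=> y z; rewrite !mem_sort !mem_undup; exact: fm.
have : sorted <%R (sort <=%R (undup E)) by rewrite sort_lt_sorted undup_uniq.
have EE x : x \in E -> x \in sort <=%R (undup E) by rewrite mem_sort mem_undup.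
case: (sort _ _) fm' EE => [|x l] fm' EE => [_|xl].
  by exists 1%g => x /EE.
by have [g gE] := aut_extend_sorted xl fm'; exists g => z /EE/gE.
Qed.

(** * Piecewise linear automorphisms *)

Lemma int_homo_lt (e : int -> rat) : (forall n, e n < e (n + 1)) ->
  {homo e : m n / m < n}.
Proof.
move=> es m n mn; have -> : n = m + (`|n - m|.-1.+1)%:Z by lia.
elim: `|n - m|.-1 => [|k IH]; first exact: es.
apply: lt_trans IH _; have -> : m + k.+2%:Z = m + k.+1%:Z + 1 by lia.
exact: es.
Qed.

Lemma int_locate (e : int -> rat) (y : rat) :
  (exists n, e n <= y) -> (exists n, y < e n) -> {homo e : m n / m < n} ->
  exists n, e n <= y < e (n + 1).
Proof.
move=> [m em] [n en] eh.
have mn : m < n.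
  rewrite ltNge; apply/negP; rewrite le_eqVlt => /orP[/eqP nm|/eh nm].
    by move: en; rewrite nm ltNge em.
  by have := lt_trans (le_lt_trans em en) nm; rewrite ltxx.
move: en; have -> : n = m + (`|n - m|.-1.+1)%:Z by lia.
elim: `|n - m|.-1 => [|k IH] yk; first by exists m; rewrite em.
case: (ltP y (e (m + k.+1%:Z))) => [/IH//|yk'].
exists (m + k.+1%:Z); rewrite yk'/=.
by have -> : m + k.+1%:Z + 1 = m + k.+2%:Z by lia.
Qed.

Lemma int_unbounded (e : int -> rat) : (forall n, e n + 1 <= e (n + 1)) ->
  forall y, (exists n, e n <= y) /\ (exists n, y < e n).
Proof.
move=> es.
have up (k : nat) : e 0 + k%:R <= e k%:Z.
  elim: k => [|k IH]; first by rewrite addr0.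
  have := es k; have -> : k%:Z + 1 = k.+1%:Z by lia.
  by move: IH; rewrite -natr1; lra.
have dn (k : nat) : e (- k%:Z) <= e 0 - k%:R.
  elim: k => [|k IH]; first by rewrite oppr0 subr0.
  have := es (- k.+1%:Z); have -> : - k.+1%:Z + 1 = - k%:Z by lia.
  by move: IH; rewrite -natr1; lra.
move=> y; pose k := Num.bound `|y - e 0|.
have : `|y - e 0| < k%:R by exact: archi_boundP.
rewrite ltr_norml => /andP[y1 y2]; split.
  by exists (- k%:Z); apply: le_trans (dn k) _; lra.
by exists k%:Z; apply: lt_le_trans (up k); lra.
Qed.

(** Linear interpolation between consecutive integers; unboundedness of [e] on both sides makes it
    onto. *)
Lemma aut_interpolate (e : int -> rat) : (forall n, e n < e (n + 1)) ->
  (forall y, exists n, e n <= y) -> (forall y, exists n, y < e n) ->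
  exists g : aut, forall n, g n%:~R = e n.
Proof.
move=> es lo hi; have eh := int_homo_lt es.
pose d n := e (n + 1) - e n; have d0 n : 0 < d n by rewrite subr_gt0.
pose f x := e (Num.floor x) + (x - (Num.floor x)%:~R) * d (Num.floor x).
have f_lo x : e (Num.floor x) <= f x.
  by rewrite lerDl mulr_ge0 ?subr_ge0 ?floor_le// ltW.
have f_hi x : f x < e (Num.floor x + 1).
  rewrite -ltrBrDl -[X in _ < X]mul1r ltr_pM2r// ltrBlDl.
  by rewrite -(intrD _ _ 1) floorD1_gt.
have [||g gE] := @aut_exists f.
- move=> x y xy; have := le_floor (ltW xy); rewrite le_eqVlt => /orP[/eqP xy'|xy'].
    by rewrite /f xy' ltrD2l ltr_pM2r// ltrD2r.
  apply: lt_le_trans (f_hi x) _; apply: le_trans (f_lo y).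
  by move: xy'; rewrite -lezD1 le_eqVlt => /orP[/eqP->//|/eh/ltW].
- move=> y; have [n /andP[ny yn]] := int_locate (lo y) (hi y) eh.
  have fl : Num.floor (n%:~R + (y - e n) / d n) = n.
    apply: floor_def; rewrite lerDl divr_ge0 ?subr_ge0//; last exact: ltW.
    by rewrite intrD ltrD2l ltr_pdivrMr// mul1r ltrD2r.
  exists (n%:~R + (y - e n) / d n).
  by rewrite /f fl addrAC subrr add0r divfK ?lt0r_neq0// addrC subrK.
by exists g => n; rewrite gE /f intrKfloor subrr mul0r addr0.
Qed.

Definition interleave (f g : int -> rat) (m : int) : rat :=
  if (m %% 2)%Z == 0 then f (m %/ 2)%Z else g (m %/ 2)%Z.

Lemma interleave_even (f g : int -> rat) (n : int) : interleave f g (2 * n) = f n.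
Proof.
by rewrite /interleave; have [-> ->] : ((2 * n) %% 2)%Z = 0 /\ ((2 * n) %/ 2)%Z = n by lia.
Qed.

Lemma interleave_odd (f g : int -> rat) (n : int) : interleave f g (2 * n + 1) = g n.
Proof.
rewrite /interleave.
by have [-> ->] : ((2 * n + 1) %% 2)%Z = 1 /\ ((2 * n + 1) %/ 2)%Z = n by lia.
Qed.

Lemma aut_interleave (f g : int -> rat) : (forall n, f n < g n < f (n + 1)) ->
  (forall y, exists n, f n <= y) -> (forall y, exists n, y < f n) ->
  exists u : aut, forall n : int, u (2 * n)%:~R = f n /\ u (2 * n + 1)%:~R = g n.
Proof.
move=> fg lo hi; have [|||u uE] := @aut_interpolate (interleave f g).
- move=> m; have [[q ->]|[q ->]] : (exists q, m = 2 * q) \/ (exists q, m = 2 * q + 1).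
  + have [h|h] : (m %% 2)%Z = 0 \/ (m %% 2)%Z = 1 by lia.
      by left; exists (m %/ 2)%Z; lia.
    by right; exists (m %/ 2)%Z; lia.
  + by rewrite interleave_odd interleave_even; case/andP: (fg q).
  + have -> : 2 * q + 1 + 1 = 2 * (q + 1) by lia.
    by rewrite interleave_odd interleave_even; case/andP: (fg q).
- by move=> y; have [n fn] := lo y; exists (2 * n); rewrite interleave_even.
- by move=> y; have [n fn] := hi y; exists (2 * n); rewrite interleave_even.
by exists u => n; rewrite !uE interleave_odd interleave_even.
Qed.

(** * Automorphisms acting in disjoint intervals *)

(** Each [chi i] identifies the rationals with a convex set; since these sets are disjoint,
    automorphisms can be prescribed independently on all of them. *)
Record chart_family (I : Type) (chi : I -> rat -> rat) : Prop := ChartFamily {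
  chart_mono : forall i, {homo chi i : x y / x < y};
  chart_conv : forall i u v y, chi i u < y < chi i v -> exists w, chi i w = y;
  chart_disj : forall i j u v, chi i u = chi j v -> i = j
}.

Section Charts.
Variables (I : Type) (chi : I -> rat -> rat).
Hypothesis chiP : chart_family chi.

Lemma chart_lt (i : I) (x y : rat) : (chi i x < chi i y) = (x < y).
Proof.
case: (ltgtP x y) => [xy|yx|->]; last by rewrite ltxx.
- exact: (chart_mono chiP).
- by apply/negbTE; rewrite -leNgt ltW//; exact: (chart_mono chiP).
Qed.

Lemma chart_inj (i : I) : injective (chi i).
Proof.
move=> x y xy; have := chart_lt i x y; have := chart_lt i y x.
by rewrite xy ltxx; case: ltgtP.
Qed.

Lemma chart_or (x : rat) :
  (exists i u, x = chi i u) \/ (forall i u, chi i u <> x).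
Proof.
have [[i [u <-]]|h] := pselect (exists i u, chi i u = x); first by left; exists i, u.
by right=> i u e; apply: h; exists i, u.
Qed.

(** By convexity, a point outside a chart cannot lie between two of its values. *)
Lemma chart_sep_lt (i : I) (u v x : rat) :
  (forall w, chi i w <> x) -> chi i u < x -> chi i v < x.
Proof.
move=> nx ux; rewrite ltNge le_eqVlt; apply/negP => /orP[/eqP e|xv].
  by apply: (nx v).
by have [|w] := chart_conv chiP (i := i) (u := u) (v := v) (y := x); rewrite ?ux//; exact: nx.
Qed.

Lemma chart_sep_gt (i : I) (u v x : rat) :
  (forall w, chi i w <> x) -> x < chi i u -> x < chi i v.
Proof.
move=> nx ux; rewrite ltNge le_eqVlt; apply/negP => /orP[/eqP e|xv].
  by apply: (nx v).
by have [|w] := chart_conv chiP (i := i) (u := v) (v := u) (y := x); rewrite ?ux ?xv//; exact: nx.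
Qed.

(** The family [k] acts through the charts and trivially elsewhere. Order between different charts
    is kept because each chart lies on one side of any point outside it. *)
Lemma chart_action : exists tau : (I -> aut) -> aut,
  (forall k i u, tau k (chi i u) = chi i (k i u)) /\
  (forall k x, (forall i u, chi i u <> x) -> tau k x = x).
Proof.
suff : forall k : I -> aut, exists t : aut,
    (forall i u, t (chi i u) = chi i (k i u)) /\
    (forall x, (forall i u, chi i u <> x) -> t x = x).
  move=> /choice[tau tauP]; exists tau.
  by split=> k; have [] := tauP k.
move=> k; pose f x := if pselect (exists p : I * rat, chi p.1 p.2 = x) is left e
  then chi (projT1 (cid e)).1 (k (projT1 (cid e)).1 (projT1 (cid e)).2) else x.
have fE i u : f (chi i u) = chi i (k i u).
  rewrite /f; case: pselect => [e|/(_ (ex_intro _ (i, u) erefl))//].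
  case: (cid e) => -[j v] /= e'; have ji := chart_disj chiP e'.
  by rewrite ji in e' *; rewrite (chart_inj e').
have fN x : (forall i u, chi i u <> x) -> f x = x.
  by move=> nx; rewrite /f; case: pselect => // e; case: (nx _ _ (projT2 (cid e))).
have [||t tf] := @aut_exists f.
- move=> x y; have [[i [u ->]]|nx] := chart_or x; have [[j [v ->]]|ny] := chart_or y.
  + have [ij|ij] := pselect (i = j).
      by rewrite -ij !fE !chart_lt aut_lt.
    move=> uv; rewrite !fE; apply: (@chart_sep_lt i u) => [w e|].
      by apply: ij; apply: (chart_disj chiP e).
    by apply: (@chart_sep_gt j v) => // w e; apply: ij; rewrite (chart_disj chiP e).
  + by move=> uy; rewrite fE (fN y)//; exact: chart_sep_lt uy.
  + by move=> xv; rewrite fE (fN x)//; exact: chart_sep_gt xv.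
  + by rewrite !fN.
- move=> y; have [[i [u ->]]|ny] := chart_or y; last by exists y; exact: fN.
  by exists (chi i (((k i)^-1)%g u)); rewrite fE autKV.
by exists t; split=> [i u|x nx]; rewrite tf ?fE ?fN.
Qed.

(** The condition on the inverse of [g] makes the induced map onto. *)
Lemma chart_pullback (i : I) (g : aut) :
  (forall u, exists v, g (chi i u) = chi i v) ->
  (forall u, exists v, (g^-1)%g (chi i u) = chi i v) ->
  exists k : aut, forall u, g (chi i u) = chi i (k u).
Proof.
move=> /choice[f fE] gV; have [||k kf] := @aut_exists f.
- by move=> x y xy; rewrite -(chart_lt i) -!fE aut_lt chart_lt.
- move=> y; have [x gx] := gV y; exists x.
  by apply: (@chart_inj i); rewrite -fE -gx autKV.
by exists k => u; rewrite kf.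
Qed.

End Charts.

Lemma chart_actionM (I : Type) (chi : I -> rat -> rat) (tau : (I -> aut) -> aut) :
  (forall k i u, tau k (chi i u) = chi i (k i u)) ->
  (forall k x, (forall i u, chi i u <> x) -> tau k x = x) ->
  forall f g, tau (fun c => f c * g c)%g = (tau f * tau g)%g.
Proof.
move=> tE tN f g; apply: autP => x; rewrite autM.
have [[i [u ->]]|h] := chart_or chi x; first by rewrite !tE.
by rewrite !tN.
Qed.

(** * Diagonal arguments and commutators *)

(** Cantor's diagonal set [D] refutes injectivity of [kappa]; the two colliding sets are named so
    that [i] lies in [B]. *)
Lemma cantor_nat (kappa : (nat -> bool) -> nat) :
  exists A B i, [/\ kappa A = kappa B, A i = false & B i = true].
Proof.
apply: contrapT => h.
have kinj A B : kappa A = kappa B -> A = B.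
  move=> AB; apply/funext => i; case Ai : (A i); case Bi : (B i) => //.
    by exfalso; apply: h; exists B, A, i.
  by exfalso; apply: h; exists A, B, i.
pose D n := ~~ (xget (fun=> false) [set A | kappa A = n] n).
have : xget (fun=> false) [set A | kappa A = kappa D] = D.
  by apply: kinj; case: xgetP => [_ ->//|/(_ D) nD]; case: nD.
move=> e; have : D (kappa D) = ~~ D (kappa D) by rewrite {1}/D e.
by case: (D _).
Qed.

(* [H] is a subgroup of countable index. *)
Record small (H : set aut) : Prop := Small {
  smallM : forall f g, H f -> H g -> H (f * g)%g;
  smallV : forall f, H f -> H (f^-1)%g;
  small_coset : exists kappa : aut -> nat,
    forall f g, kappa f = kappa g -> H (f^-1 * g)%g
}.

Lemma small1 (H : set aut) : small H -> H 1%g.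
Proof.
move=> HH; have [kappa kH] := small_coset HH.
by rewrite -(mulVg 1%g); exact: kH.
Qed.

(* Writing [t = (i, j)]: first [i] is chosen such that every family agrees on
   the charts labelled [(i, _)] with some [h] in [H], then [j] such that every
   family supported on the charts labelled [(i, j)] agrees there with some [y]
   in [H] supported on the charts labelled [(i, _)]; the commutator of [h] and
   [y] only lives on the charts labelled [t]. Failure of either choice yields
   an injection of the subsets of [nat] into the cosets of [H]. *)
Lemma small_commutators (I : Type) (lab : I -> nat * nat) (tau : (I -> aut) -> aut)
    (H : set aut) :
  (forall f g, tau (fun c => f c * g c)%g = (tau f * tau g)%g) -> small H ->
  exists t, forall u w : I -> aut,
    (forall c, lab c <> t -> u c = 1%g) -> (forall c, lab c <> t -> w c = 1%g) ->
    H (tau u * tau w * (tau u)^-1 * (tau w)^-1)%g.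
Proof.
move=> tauM HH; have [kappa kH] := small_coset HH.
have tau1 : tau (fun=> 1%g) = 1%g.
  apply: (@mulgI _ (tau (fun=> 1%g))); rewrite mulg1 -tauM.
  by congr tau; apply/funext => c; rewrite mulg1.
have tauV f : tau (fun c => (f c)^-1)%g = ((tau f)^-1)%g.
  apply: (@mulgI _ (tau f)); rewrite mulgV -tauM -tau1.
  by congr tau; apply/funext => c; rewrite mulgV.
have [i iP] : exists i, forall u : I -> aut, exists h : I -> aut,
    H (tau h) /\ forall c, (lab c).1 = i -> h c = u c.
  apply: contrapT => /forallNP h.
  have {}h i : exists u : I -> aut, forall h,
      H (tau h) -> ~ forall c, (lab c).1 = i -> h c = u c.
    have /existsNP[u /forallNP hu] := h i.
    by exists u => k Hk kc; apply: (hu k).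
  have {h}[u uP] := choice h.
  pose f (A : nat -> bool) c := if A (lab c).1 then u (lab c).1 c else 1%g.
  have [A [B [i [AB Ai Bi]]]] := cantor_nat (kappa \o tau \o f).
  (* On row [i] the quotient of the two families is [u i], because [i] is in [B] and not in [A]. *)
  have := kH _ _ AB; rewrite -tauV -tauM => /(uP i); apply => c ci.
  by rewrite /f/= ci Ai Bi invg1 mul1g.
suff [j jP] : exists j, forall u w : I -> aut,
    (forall c, lab c <> (i, j) -> u c = 1%g) -> (forall c, lab c <> (i, j) -> w c = 1%g) ->
    H (tau u * tau w * (tau u)^-1 * (tau w)^-1)%g.
  by exists (i, j).
apply: contrapT => /forallNP h.
have {}h j : exists uw : (I -> aut) * (I -> aut), [/\
    forall c, lab c <> (i, j) -> uw.1 c = 1%g,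
    forall c, lab c <> (i, j) -> uw.2 c = 1%g &
    ~ H (tau uw.1 * tau uw.2 * (tau uw.1)^-1 * (tau uw.2)^-1)%g].
  have /existsNP[u /existsNP[w /not_implyP[hu /not_implyP[hw hH]]]] := h j.
  by exists (u, w).
have {h}[uw uwP] := choice h.
pose f (A : nat -> bool) c :=
  if ((lab c).1 == i) && A (lab c).2 then (uw (lab c).2).2 c else 1%g.
have [A [B [j [AB Aj Bj]]]] := cantor_nat (kappa \o tau \o f).
have := kH _ _ AB; rewrite -tauV -tauM => Hy.
have [h [Hh hE]] := iP (uw j).1; have [u1 w1] := uwP j; apply.
set y := fun c => _ in Hy.
have := smallM HH (smallM HH (smallM HH Hh Hy) (smallV HH Hh)) (smallV HH Hy).
rewrite -!tauV -!tauM; congr (H (tau _)); apply/funext => c.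
have [ci|ci] := eqVneq (lab c).1 i; last first.
  have lc : lab c <> (i, j) by move=> e; rewrite e eqxx in ci.
  by rewrite u1// w1// /y /f (negbTE ci)/= !(invg1, mulg1) mulgV.
have [cj|cj] := eqVneq (lab c).2 j.
  by rewrite hE// /y /f ci cj eqxx Aj Bj/= invg1 mul1g.
have lc : lab c <> (i, j) by move=> e; rewrite e eqxx in cj.
by rewrite hE// u1// w1// !(invg1, mulg1, mul1g) mulgV.
Qed.

(* Take for [f] the product of all the conjugates of [k] by the nonnegative
   powers of the translation [T]. *)
Lemma aut_swindle (k T : aut) :
  (forall z, ~~ (0 < z < 1) -> k z = z) -> (forall z, T z = z + 1) ->
  exists f : aut, k = (f * T * f^-1 * T^-1)%g.
Proof.
move=> k1 TE; pose fl (x : rat) := (Num.floor x)%:~R : rat.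
have k0 : k 0 = 0 by exact: k1.
have k11 : k 1 = 1 by exact: k1.
have k01 z : 0 <= z < 1 -> 0 <= k z < 1.
  move=> /andP[z0 z1]; rewrite -{1}k0 aut_le z0/=.
  by rewrite -k11 aut_lt.
have fr z : 0 <= z - fl z < 1.
  rewrite subr_ge0 floor_le/= ltrBlDl.
  by rewrite /fl -(intrD _ _ 1) floorD1_gt.
(* A copy of [k] on every unit interval starting at a nonnegative integer. *)
pose f z := if z < 0 then z else fl z + k (z - fl z).
have flk z (m : int) : 0 <= z < 1 -> fl (m%:~R + k z) = m%:~R.
  move=> /k01/andP[z0 z1]; congr _%:~R; apply: floor_def.
  by rewrite lerDl z0 intrD ltrD2l z1.
have fl0 z : 0 <= z -> 0 <= fl z by rewrite /fl ler0z floor_ge0.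
have f0 z : 0 <= z -> 0 <= f z.
  move=> z0; rewrite /f ltNge z0/= addr_ge0 ?fl0//.
  by have /k01/andP[] := fr z.
have [||F FE] := @aut_exists f.
- move=> x y xy; have [x0|x0] := ltP x 0.
    have [y0|y0] := ltP y 0; first by rewrite /f x0 y0.
    by rewrite {1}/f x0; apply: lt_le_trans x0 (f0 _ y0).
  have y0 := le_trans x0 (ltW xy); rewrite /f (ltNge x) (ltNge y) x0 y0/=.
  have := le_floor (ltW xy); rewrite le_eqVlt => /orP[/eqP e|e].
    by rewrite /fl -e ltrD2l aut_lt ltrD2r.
  apply: (@lt_le_trans _ _ (fl x + 1)).
    by rewrite ltrD2l; have /k01/andP[] := fr x.
  apply: (@le_trans _ _ (fl y)).
    by rewrite /fl -(intrD _ _ 1) ler_int lezD1.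
  by rewrite lerDl; have /k01/andP[] := fr y.
- move=> y; have [y0|y0] := ltP y 0; first by exists y; rewrite /f y0.
  exists (fl y + (k^-1)%g (y - fl y)).
  have /andP[z0 z1] := fr y.
  have kz : 0 <= (k^-1)%g (y - fl y) < 1.
    by rewrite -(aut_le k) -(aut_lt k _ 1) autKV k0 k11 z0 z1.
  have e : fl (fl y + (k^-1)%g (y - fl y)) = fl y.
    congr _%:~R; apply: floor_def; rewrite lerDl intrD ltrD2l.
    by case/andP: kz => -> ->.
  rewrite /f ltNge addr_ge0 ?fl0//=; last by case/andP: kz.
  by rewrite e addrAC subrr add0r autKV addrC subrK.
(* Equivalently, [F] is [k] times its conjugate by [T]: the conjugate carries all the copies of [k]
   except the first. *)
exists F; suff : (k * T * F)%g = (F * T)%g.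
  by move=> <-; rewrite -!mulgA mulVKg mulgV mulg1.
apply: autP => z; rewrite !autM !FE !TE.
have [z0|z0] := ltP z 0; last first.
  have z1 : 0 <= z + 1 by rewrite addr_ge0.
  rewrite k1; last by rewrite negb_and orbC -!leNgt lerDr f0.
  rewrite /f !ltNge z0 z1/=.
  have -> : fl (z + 1) = fl z + 1.
    by rewrite /fl -(intrD _ _ 1); congr _%:~R; rewrite floorDrz// floor1.
  by rewrite opprD addrACA subrr addr0 addrAC.
rewrite /f z0; have [z1|z1] := ltP (z + 1) 0.
  by rewrite k1// negb_and -!leNgt ltW.
have -> : fl (z + 1) = 0.
  rewrite /fl; have -> : Num.floor (z + 1) = 0 by apply: floor_def; rewrite z1 add0r gtrDr.
  by [].
by rewrite add0r subr0.
Qed.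

(** * Subgroups of countable index *)

(* Baire category: were every coset of H nowhere dense, a back-and-forth
   construction would produce an automorphism in none of them. *)
Lemma small_dense (H : set aut) : small H ->
  exists F : seq rat, forall g : aut, {in F, g =1 id} ->
    forall E : seq rat, exists2 h, H h & {in E, h =1 g}.
Proof.
move=> HH; have [kappa kH] := small_coset HH.
suff [n [g0 [F nF]]] : exists n (g0 : aut) (F : seq rat), forall g : aut, {in F, g =1 g0} ->
    forall E : seq rat, exists2 g' : aut, kappa g' = n & {in E, g' =1 g}.
  exists F => g gF E.
  (* Since [g1] agrees with [g0] on [F], so does [g1 * g]; hence [g1 * g] is approximated by some
     [g2] with the same [kappa] value as [g1]. *)
  have [g1 k1 g1F] := nF g0 (fun _ _ => erefl) F.
  have [|g2 k2 g2E] := nF (g1 * g)%g _ E.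
    by move=> x xF; rewrite autM gF// g1F.
  exists (g1^-1 * g2)%g; first by apply: kH; rewrite k1 k2.
  by move=> x xE; rewrite autM g2E// autM autK.
apply: contrapT => h.
have {}h (p : nat * aut * seq rat) : exists r : aut * seq rat,
    {in p.2, r.1 =1 p.1.2} /\
    forall g' : aut, {in r.2, g' =1 r.1} -> kappa g' <> p.1.1.
  case: p => -[n g0] F /=; apply: contrapT => /forallNP hF; apply: h.
  exists n, g0, F => g gF E; apply: contrapT => hE.
  by apply: (hF (g, E)); split=> //= g' g'E kg'; apply: hE; exists g'.
have [nx nxP] := choice h.
pose q n : rat := odflt 0 (unpickle n).
(* Stage [n] excludes the value [n] of [kappa] and puts the rational [q n] into both the domain and
   the range of the finite approximation. *)
pose next n (s : aut * seq rat) := let r := nx (n, s.1, s.2) in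
  (r.1, s.2 ++ r.2 ++ [:: q n; (r.1^-1)%g (q n)]).
pose st := fix st n := if n is m.+1 then next m (st m) else (1%g, [::]).
have stS n x : x \in (st n).2 -> x \in (st n.+1).2.
  by move=> xn; rewrite /= mem_cat xn.
have stE n : {in (st n).2, (st n.+1).1 =1 (st n).1}.
  by have [] := nxP (n, (st n).1, (st n).2).
have st_le m n : (m <= n)%N ->
    {subset (st m).2 <= (st n).2} /\ {in (st m).2, (st n).1 =1 (st m).1}.
  elim: n => [|n IH]; first by rewrite leqn0 => /eqP->; split.
  rewrite leq_eqVlt => /orP[/eqP->|]; first by split.
  rewrite ltnS => /IH[s e].
  by split=> x xm; [exact/stS/s|rewrite stE ?e// s].
have qst n : q n \in (st n.+1).2 /\ (((st n.+1).1)^-1)%g (q n) \in (st n.+1).2.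
  by rewrite !mem_cat !inE !eqxx !orbT.
have qpick x : q (pickle x) = x by rewrite /q pickleK.
pose f x := (st (pickle x).+1).1 x.
have fE n x : x \in (st n).2 -> f x = (st n).1 x.
  move=> xn; rewrite /f; have [nx'|/ltnW nx'] := leqP n (pickle x).+1.
    by have [_ ->] := st_le _ _ nx'.
  by have [_ ->//] := st_le _ _ nx'; rewrite -{1}(qpick x); have [] := qst (pickle x).
have fbig n x : ((pickle x).+1 <= n)%N -> f x = (st n).1 x.
  move=> xn; apply: fE; have [+ _] := st_le _ _ xn; apply.
  by rewrite -{1}(qpick x); have [] := qst (pickle x).
have [||g gf] := @aut_exists f.
- move=> x y xy; set n := maxn (pickle x).+1 (pickle y).+1.
  by rewrite (fbig n x) ?leq_maxl// (fbig n y) ?leq_maxr// aut_lt.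
- move=> y; exists ((((st (pickle y).+1).1)^-1)%g y).
  rewrite (fE (pickle y).+1) ?autKV//; have [_] := qst (pickle y).
  by rewrite qpick.
have [_ /(_ g)] := nxP (kappa g, (st (kappa g)).1, (st (kappa g)).2).
apply=> // x xr; rewrite gf (fE (kappa g).+1)//.
by rewrite /= !mem_cat xr orbT.
Qed.

(** * Cells, stripes and almost disjoint branches *)

(** An order isomorphism onto the open interval from -1 to 1. *)
Definition squash (x : rat) : rat := x / (1 + `|x|).

Lemma squash_den (x : rat) : 0 < 1 + `|x|.
Proof. by rewrite ltr_pwDl. Qed.

Lemma squash_lt : {homo squash : x y / x < y}.
Proof.
move=> x y xy; rewrite /squash ltr_pdivrMr ?squash_den// mulrAC.
rewrite ltr_pdivlMr ?squash_den//.
case: (ger0P x) => x0; case: (ger0P y) => y0; nra.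
Qed.

Lemma squash_bound (x : rat) : -1 < squash x < 1.
Proof.
rewrite /squash ltr_pdivlMr ?squash_den// ltr_pdivrMr ?squash_den//.
by case: (ger0P x) => x0; apply/andP; split; lra.
Qed.

Lemma squash_onto (y : rat) : -1 < y < 1 -> exists x, squash x = y.
Proof.
move=> /andP[y1 y2]; have d0 : 0 < 1 - `|y| by rewrite subr_gt0 ltr_norml y1.
exists (y / (1 - `|y|)); rewrite /squash normrM normfV (ger0_norm (ltW d0)).
have d1 : 1 - `|y| != 0 by rewrite gt_eqF.
by rewrite -{2}[1](divff d1) -mulrDl subrK mul1r invrK divfK.
Qed.

Lemma squash0 : squash 0 = 0. Proof. by rewrite /squash mul0r. Qed.
Lemma squash1 : squash 1 = 1 / 2. Proof. by rewrite /squash normr1. Qed.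

(* Every nonzero integer is [cell_index t n] for exactly one pair [(t, n)]. *)
Definition cell_index (t : nat) (n : int) : int := 2 ^+ t * (2 * n + 1).

Lemma cell_index_inj (s t : nat) (m n : int) :
  cell_index s m = cell_index t n -> s = t /\ m = n.
Proof.
have p0 k : 0 < 2 ^+ k :> int by rewrite exprn_gt0.
wlog st : s t m n / (s <= t)%N => [hw|].
  case: (leqP s t) => [|/ltnW] st e; first exact: hw.
  by have [-> ->] := hw _ _ _ _ st (esym e).
rewrite /cell_index -(subnKC st) exprD -mulrA => /(mulfI (lt0r_neq0 (p0 s))).
case: (t - s)%N => [|k]; first by rewrite expr0 mul1r addn0 => e; split=> //; lia.
by rewrite exprS -mulrA => e; exfalso; lia.
Qed.

Lemma cell_index_step (t : nat) (n : int) :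
  cell_index t n + 2 <= cell_index t (n + 1).
Proof.
have p0 : 0 < 2 ^+ t :> int by rewrite exprn_gt0.
rewrite /cell_index; nia.
Qed.

Definition cell_lo (t : nat) (n : int) : rat := (cell_index t n)%:~R + 1 / 2.
Definition cell_hi (t : nat) (n : int) : rat := (cell_index t n)%:~R + 3 / 4.
Definition in_cells (t : nat) : set rat :=
  [set x | exists n, cell_lo t n < x < cell_hi t n].

(** The chart fills an open unit interval, while the cell corresponds to arguments between 0 and 1
    only; this leaves room for the translation in the swindle. *)
Definition cell_chart (c : int * (nat * nat)) (x : rat) : rat :=
  (cell_index (pickle c.2) c.1)%:~R + (1 + squash x) / 2.

Lemma cell_chart_family : chart_family cell_chart.
Proof.
split.
- by move=> c x y /squash_lt xy; rewrite /cell_chart; lra.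
- move=> c u v y /andP[uy yv]; set p : rat := (cell_index (pickle c.2) c.1)%:~R.
  have [|w wE] := @squash_onto (2 * (y - p) - 1).
    have := squash_bound u; have := squash_bound v.
    move: uy yv; rewrite /cell_chart -/p => ? ? /andP[? ?] /andP[? ?].
    by apply/andP; split; lra.
  by exists w; rewrite /cell_chart -/p wE; lra.
- move=> [n s] [m t] u v; rewrite /cell_chart/= => e.
  suff /cell_index_inj[/(pcan_inj pickleK)<- <-] :
    cell_index (pickle s) n = cell_index (pickle t) m by [].
  have fl (z : int) x : Num.floor (z%:~R + (1 + squash x) / 2) = z.
    apply: floor_def; rewrite intrD; have /andP[? ?] := squash_bound x.
    by apply/andP; split; lra.
  by rewrite -[LHS](fl _ u) e fl.
Qed.

(** Through each chart of the chosen label, [g] is supported between 0 and 1, hence by the swindle a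
    commutator with [T]. Assembled over all cells, these form one commutator of two families living
    on a single label. *)
Lemma small_cells (H : set aut) : small H ->
  exists t, forall g : aut, (forall x, ~ in_cells t x -> g x = x) -> H g.
Proof.
move=> HH; have chiP := cell_chart_family.
have [tau [tauE tauN]] := chart_action chiP.
have tauM := chart_actionM tauE tauN.
have [t tP] := small_commutators snd tauM HH.
exists (pickle t) => g gN.
have lo n : cell_chart (n, t) 0 = cell_lo (pickle t) n.
  by rewrite /cell_chart squash0 addr0.
have hi n : cell_chart (n, t) 1 = cell_hi (pickle t) n.
  by rewrite /cell_chart squash1 /cell_hi/=; congr (_ + _).
have inN c u : (forall n, c = (n, t) -> ~~ (0 < u < 1)) ->
    ~ in_cells (pickle t) (cell_chart c u).
  move=> cu [n]; rewrite -lo -hi => h.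
  have [w e] := chart_conv chiP h; have cE := chart_disj chiP e.
  by have /negP := cu n (esym cE); apply; move: h; rewrite -cE !(chart_lt chiP).
have pull (g' : aut) : (forall x, ~ in_cells (pickle t) x -> g' x = x) ->
    forall n u, exists v, g' (cell_chart (n, t) u) = cell_chart (n, t) v.
  move=> g'N n u; have [/andP[u0 u1]|/negP u01] := boolP (0 < u < 1); last first.
    by exists u; apply: g'N; apply: inN => m _; exact/negP.
  have fx z : ~~ (0 < z < 1) -> g' (cell_chart (n, t) z) = cell_chart (n, t) z.
    by move=> z01; apply: g'N; apply: inN.
  have [|w wE] := chart_conv chiP (i := (n, t)) (u := 0) (v := 1)
      (y := g' (cell_chart (n, t) u)); last by exists w.
  by rewrite -(fx 0)// -(fx 1)// !aut_lt !(chart_lt chiP) u0.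
have gVN x : ~ in_cells (pickle t) x -> (g^-1)%g x = x.
  by move=> /gN; exact: autV_fix.
have /choice[k kE] n := chart_pullback chiP (pull g gN n) (pull _ gVN n).
have [T TE] : exists T : aut, forall z, T z = z + 1.
  apply: aut_exists; first by move=> x y xy; rewrite ltrD2r.
  by move=> y; exists (y - 1); rewrite subrK.
have kN n z : ~~ (0 < z < 1) -> k n z = z.
  move=> z01; apply: (chart_inj chiP (i := (n, t))); rewrite -kE; apply: gN.
  by apply: inN => m _.
have /choice[f fE] n := aut_swindle (kN n) TE.
pose u (c : int * (nat * nat)) := if c.2 == t then f c.1 else 1%g.
pose w (c : int * (nat * nat)) := if c.2 == t then T else 1%g.
have uN c : c.2 <> t -> u c = 1%g by move=> /eqP/negbTE ct; rewrite /u ct.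
have wN c : c.2 <> t -> w c = 1%g by move=> /eqP/negbTE ct; rewrite /w ct.
have tauV v : tau (fun c => (v c)^-1)%g = ((tau v)^-1)%g.
  apply: (@mulgI _ (tau v)); rewrite mulgV -tauM; apply: autP => x.
  have [[i [y ->]]|nx] := chart_or cell_chart x; last by rewrite tauN.
  by rewrite tauE mulgV.
have := tP u w uN wN; rewrite -!tauV -!tauM; congr H; apply: autP => x.
have [[[n s] [y ->]]|nx] := chart_or cell_chart x; last first.
  rewrite tauN// gN// => -[n]; rewrite -lo -hi => h.
  by have [z zE] := chart_conv chiP h; apply: (nx _ _ zE).
rewrite tauE /u /w/=; case: eqP => [->|st]; first by rewrite kE fE.
rewrite gN//; apply: inN => m [_ e].
by case: st.
Qed.

(* The sets of codes of the prefixes of the branches [A] form an uncountable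
   almost disjoint family. *)
Fixpoint branch_code (A : nat -> bool) (k : nat) : nat :=
  if k is j.+1 then (branch_code A j).*2 + A j else 1%N.

Lemma branch_code_gt0 (A : nat -> bool) (k : nat) : (0 < branch_code A k)%N.
Proof. by elim: k => //= k; lia. Qed.

Lemma branch_code_inj (A B : nat -> bool) (m n : nat) :
  branch_code A m = branch_code B n ->
  m = n /\ forall i, (i < m)%N -> A i = B i.
Proof.
elim: m n => [|m IH] [|n] //=.
- by have := branch_code_gt0 B n; lia.
- by have := branch_code_gt0 A m; lia.
move=> e; have [e1 e2] : branch_code A m = branch_code B n /\ A m = B n.
  by move: e; case: (A m); case: (B n); lia.
have [mn mB] := IH _ e1; split; first by rewrite mn.
by move=> i; rewrite ltnS leq_eqVlt => /orP[/eqP->|/mB//]; rewrite e2 mn.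
Qed.

(** Doubling keeps different values at distance at least two, so unit intervals starting at them are
    disjoint; the mirror image makes the sequence unbounded on both sides. *)
Definition stripe (A : nat -> bool) (n : int) : int :=
  match n with
  | Posz k => 2 * (branch_code A k)%:Z
  | Negz k => - (2 * (branch_code A k)%:Z)
  end.

Lemma stripe_step (A : nat -> bool) (n : int) : stripe A n + 2 <= stripe A (n + 1).
Proof.
case: n => [k|[|k]].
- have -> : Posz k + 1 = Posz k.+1 by lia.
  by rewrite /=; have := branch_code_gt0 A k; lia.
- by [].
- have -> : Negz k.+1 + 1 = Negz k by lia.
  by rewrite /=; have := branch_code_gt0 A k; lia.
Qed.

Lemma stripe_even (A : nat -> bool) (n : int) : exists m, stripe A n = 2 * m.
Proof.
case: n => k; first by eexists.
by exists (- (branch_code A k)%:Z); rewrite /=; lia.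
Qed.

(** Equal codes come from equal prefixes, and prefixes longer than [i] differ at [i]. The lower
    bound is shifted because [Negz k] is [- (k + 1)]. *)
Lemma stripe_almost_disjoint (A B : nat -> bool) (i : nat) (m n : int) :
  A i <> B i -> stripe A m = stripe B n -> - i%:Z - 1 <= m <= i%:Z.
Proof.
move=> AB; suff key k l : branch_code A k = branch_code B l -> (k <= i)%N.
  have := branch_code_gt0 A; have := branch_code_gt0 B.
  case: m n => k [l|l] /= A0 B0 e.
  - have ki : (k <= i)%N by apply: (key k l); lia.
    by apply/andP; split; lia.
  - by have := A0 l; have := B0 k; lia.
  - by have := A0 l; have := B0 k; lia.
  - have ki : (k <= i)%N by apply: (key k l); lia.
    by apply/andP; split; lia.
by move=> /branch_code_inj[_ kB]; rewrite leqNgt; apply/negP => /kB.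
Qed.

Definition supp_in (a b : rat) (g : aut) : Prop :=
  forall x, ~~ (a < x < b) -> g x = x.

(** What conjugation yields when elements of [H] can carry any interval to any other. *)
Definition homogeneous (H : set aut) : Prop := forall a b a' b', a < b -> a' < b' ->
  (forall g, supp_in a b g -> H g) -> forall g, supp_in a' b' g -> H g.

(* [H] contains all automorphisms living in a sequence of cells. For each branch
   [A] some automorphism [g A] maps the gaps between the cells onto the stripes
   of [A]. Two of these are in the same coset, so almost disjointness gives an
   element [h] of [H] whose inverse maps all but finitely many gaps into cells;
   the remaining ones are dealt with by homogeneity. *)
Lemma small_fixing_quarters (H : set aut) : small H -> homogeneous H ->
  forall u : aut, (forall k : int, u (k%:~R / 4) = k%:~R / 4) -> H u.
Proof.
move=> HH hom u uq; have [t tP] := small_cells HH.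
pose a := cell_lo t; pose b := cell_hi t.
have aE n : a n = (cell_index t n)%:~R + 1 / 2 by [].
have bE n : b n = (cell_index t n)%:~R + 3 / 4 by [].
have pstep n : (cell_index t n)%:~R + 2 <= (cell_index t (n + 1))%:~R :> rat.
  by rewrite -(intrD _ _ 2) ler_int cell_index_step.
have ab n : a n < b n by rewrite aE bE; lra.
have ba n : b n < a (n + 1) by rewrite aE bE; have := pstep n; lra.
have ah : {homo a : m n / m < n}.
  by apply: int_homo_lt => n; exact: lt_trans (ab n) (ba n).
have bh : {homo b : m n / m < n}.
  by apply: int_homo_lt => n; exact: lt_trans (ba n) (ab _).
have aub y : (exists n, a n <= y) /\ (exists n, y < a n).
  by apply: int_unbounded => n; rewrite !aE; have := pstep n; lra.
have bub y : (exists n, b n <= y) /\ (exists n, y < b n).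
  by apply: int_unbounded => n; rewrite !bE; have := pstep n; lra.
have ua n : u (a n) = a n.
  have -> : a n = (4 * cell_index t n + 2)%:~R / 4 by rewrite aE intrD intrM; field.
  exact: uq.
have ub n : u (b n) = b n.
  have -> : b n = (4 * cell_index t n + 3)%:~R / 4 by rewrite bE intrD intrM; field.
  exact: uq.
have gap x : ~ in_cells t x -> exists n, b n <= x <= a (n + 1).
  move=> nx; have [n /andP[nx1 nx2]] := int_locate (bub x).1 (bub x).2 bh.
  exists n; rewrite nx1 leNgt; apply/negP => ax; apply: nx; exists (n + 1).
  by rewrite ax.
have aw m n : m <= n -> a m <= a n.
  by rewrite le_eqVlt => /orP[/eqP->//|/ah/ltW].
have bw m n : m <= n -> b m <= b n.
  by rewrite le_eqVlt => /orP[/eqP->//|/bh/ltW].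
have bN n : ~ in_cells t (b n).
  case=> m /andP[mn nm]; have [/bw|] := leP m n; first by rewrite leNgt nm.
  rewrite -lezD1 => /aw h; have := lt_trans (lt_le_trans (ba n) h) mn.
  by rewrite ltxx.
have aN n : ~ in_cells t (a n).
  case=> m /andP[mn nm]; have [/aw|] := leP n m; first by rewrite leNgt mn.
  rewrite -lezD1 => /aw h; have := lt_trans (lt_le_trans (ba m) h) nm.
  by rewrite ltxx.
(* [ux] acts inside the cells, hence lies in [H]; [uy] acts in the gaps. *)
have [|ux [uy [uxy uin uout]]] := @aut_split u (in_cells t).
  move=> x y [n /andP[nx xn]] ny; have [yx|xy] := leP y (a n).
    by exists (a n); rewrite ?ua// yx (ltW nx) orbT.
  exists (b n); rewrite ?ub// (ltW xn)/= leNgt orbC.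
  by apply/orP; right; apply/negP => yb; apply: ny; exists n; rewrite xy.
have Hux : H ux by apply: tP => x /uout[].
rewrite uxy; apply: (smallM HH) => //.
have uya n : uy (a n) = a n by have [_ ->] := uout _ (aN n).
have uyb n : uy (b n) = b n by have [_ ->] := uout _ (bN n).
have uyin x : in_cells t x -> uy x = x by case/uin.
have [|||e eE] := @aut_interleave b (fun n => a (n + 1)).
- by move=> n; rewrite ba ab.
- by move=> y; case: (bub y).
- by move=> y; case: (bub y).
pose z A n : rat := (stripe A n)%:~R.
have zstep A n : z A n + 2 <= z A (n + 1).
  by rewrite /z -(intrD _ _ 2) ler_int stripe_step.
have /choice[d dE] (A : nat -> bool) : exists d : aut, forall n : int,
    d (2 * n)%:~R = z A n /\ d (2 * n + 1)%:~R = z A n + 1.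
  have zub := @int_unbounded (z A).
  apply: aut_interleave => [n|y|y]; first by have := zstep A n; lra.
    by apply: (zub _ y).1 => n; have := zstep A n; lra.
  by apply: (zub _ y).2 => n; have := zstep A n; lra.
(* The gap from [b n] to [a (n + 1)] is sent to the unit interval starting at [stripe A n]. *)
pose g A := (d A * e^-1)%g.
have gb A n : g A (b n) = z A n by rewrite /g autM -(eE n).1 autK (dE A n).1.
have ga A n : g A (a (n + 1)) = z A n + 1.
  by rewrite /g autM -(eE n).2 autK (dE A n).2.
have [kappa kH] := small_coset HH.
have [A [B [i [AB Ai Bi]]]] := cantor_nat (kappa \o g).
have [h Hh hE] : exists2 h, H h & forall x, g A (h x) = g B x.
  by exists ((g A)^-1 * g B)%g => [|x]; [exact: kH|exact: autKV].
(* Almost disjointness leaves only gaps with index from [- i - 1] to [i]; these lie strictly between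
   [lo] and [hi]. *)
pose lo := b (- i%:Z - 2); pose hi := a (i%:Z + 2).
have [|v1 [v2 [v12 vin vout]]] := @aut_split uy [set x | lo < x < hi].
  move=> x y /andP[lx xh] ny; have [yl|ly] := leP y lo.
    by exists lo; rewrite ?uyb// yl (ltW lx) orbT.
  exists hi; rewrite ?uya// (ltW xh)/= leNgt orbC.
  by apply/orP; right; apply/negP => yh; apply: ny; rewrite /= ly.
rewrite v12; apply: (smallM HH).
  apply: (hom (a 0) (b 0) lo hi) => //.
  - apply: lt_le_trans (ba _) _; apply: aw; lia.
  - move=> g' g'N; apply: tP => x nx; apply: g'N; apply/negP => x0.
    by apply: nx; exists 0.
  - by move=> x /negP/vout[].
(* The conjugate is supported in the cells: otherwise some gap would be met by the image of another
   under [h], with an index outside the range that almost disjointness allows. *)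
have -> : v2 = (h * (h^-1 * v2 * h) * h^-1)%g.
  by apply: autP => x; rewrite !autM !autKV.
apply: (smallM HH); last exact: (smallV HH).
apply: (smallM HH) => //; apply: tP => x nx; rewrite !autM.
suff -> : v2 (h x) = h x by rewrite autK.
have [/vin[]//|ny] := pselect (lo < h x < hi); have [_ ->] := vout _ ny.
have [/uyin//|ncell] := pselect (in_cells t (h x)); exfalso.
have [n /andP[n1 n2]] := gap _ ncell; have [m /andP[m1 m2]] := gap _ nx.
have gAB : g A (h x) = g B x by exact: hE.
(* The point [g B x] lies in both unit intervals, whose left ends are even. *)
have zz : stripe A n = stripe B m.
  have [p pE] := stripe_even A n; have [q qE] := stripe_even B m.
  have : z A n <= z B m + 1.
    by rewrite -ga -gb (le_trans (y := g A (h x))) ?aut_le// gAB aut_le.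
  have : z B m <= z A n + 1.
    by rewrite -ga -gb (le_trans (y := g B x)) ?aut_le// -gAB aut_le.
  rewrite /z -!(intrD _ _ 1) !ler_int pE qE; lia.
have /andP[ni1 ni2] : - i%:Z - 1 <= n <= i%:Z.
  by apply: stripe_almost_disjoint zz; rewrite Ai Bi.
apply: ny; apply/andP; split.
  by apply: lt_le_trans n1; apply: bh; lia.
by apply: le_lt_trans n2 _; apply: ah; lia.
Qed.

(** * Conjugation, fragmentation and pointwise stabilizers *)

Lemma small_preimage (H : set aut) (phi : aut -> aut) :
  {morph phi : f g / (f * g)%g} -> small H -> small [set g | H (phi g)].
Proof.
move=> phiM HH; have phi1 : phi 1%g = 1%g.
  by apply: (@mulgI _ (phi 1%g)); rewrite -phiM !mulg1.
have phiV f : phi (f^-1)%g = ((phi f)^-1)%g.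
  by apply: (@mulgI _ (phi f)); rewrite mulgV -phiM mulgV phi1.
split=> [f g|f|] /=.
- by rewrite phiM; exact: smallM.
- by rewrite phiV; exact: smallV.
have [kappa kH] := small_coset HH; exists (kappa \o phi) => f g /= /kH.
by rewrite phiM phiV.
Qed.

Lemma conj_morph (c : aut) : {morph (fun g => c * g * c^-1)%g : f g / (f * g)%g}.
Proof. by move=> f g; rewrite -!mulgA mulKg. Qed.

Lemma homogeneous_conj (H : set aut) (c : aut) :
  homogeneous H -> homogeneous [set g | H (c * g * c^-1)%g].
Proof.
move=> hom a b a' b' ab ab' Hab g gN.
apply: (hom (c a) (c b) (c a') (c b')); rewrite ?aut_lt//.
  move=> k kN; have <- : (c * (c^-1 * k * c) * c^-1)%g = k.
    by apply: autP => x; rewrite !autM !autKV.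
  apply: Hab => x xab; rewrite !autM kN ?autK//; by rewrite !aut_lt.
move=> x xab; rewrite !autM gN ?autKV//.
by rewrite -(aut_lt c) -(aut_lt c _ b') autKV.
Qed.

(** Conjugation by an automorphism [c] sending [n / 4] to [x n] reduces this to the case of the
    quarters. *)
Lemma small_fixing_sequence (H : set aut) (x : int -> rat) :
  small H -> homogeneous H -> (forall n, x n < x (n + 1)) ->
  (forall y, exists n, x n <= y) -> (forall y, exists n, y < x n) ->
  forall u : aut, (forall n, u (x n) = x n) -> H u.
Proof.
move=> HH hom xs lo hi u ux; have [c0 c0E] := aut_interpolate xs lo hi.
have [s sE] : exists s : aut, forall z, s z = 4 * z.
  apply: aut_exists; first by move=> y z yz; rewrite ltr_pM2l.
  by move=> y; exists (y / 4); field.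
pose c := (c0 * s)%g; have cE n : c (n%:~R / 4) = x n.
  by rewrite /c autM sE -c0E; congr (c0 _); field.
suff : [set g | H (c * g * c^-1)%g] (c^-1 * u * c)%g.
  rewrite /=; congr H.
  by apply: autP => y; rewrite -!mulgA !autM !autKV.
apply: (small_fixing_quarters (small_preimage (conj_morph c) HH)) => [|k].
  exact: homogeneous_conj.
by rewrite -[LHS]/((c^-1)%g (u (c (k%:~R / 4)))) cE ux -cE autK.
Qed.

(** Starting from 0 in both directions, each new term passes the previous one and its images under
    [g] and its inverse by a margin of 1. *)
Lemma fragmentation_sequence (g : aut) : exists x : int -> rat,
  forall n, [/\ x n + 1 <= x (n + 1), g (x n) < x (n + 1) & x n < g (x (n + 1))].
Proof.
pose up z := Num.max z (Num.max (g z) ((g^-1)%g z)) + 1.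
pose dn z := Num.min z (Num.min (g z) ((g^-1)%g z)) - 1.
pose x n := match n with Posz k => iter k up 0 | Negz k => iter k.+1 dn 0 end.
have upP z : [/\ z + 1 <= up z, g z < up z & z < g (up z)].
  rewrite -(aut_lt (g^-1)%g z) autK.
  split; rewrite /up ?lerD2r ?le_max ?lexx//; apply: (@le_lt_trans _ _ (up z - 1)).
  - by rewrite /up addrK !le_max lexx !orbT.
  - by rewrite /up; lra.
  - by rewrite /up addrK !le_max lexx !orbT.
  - by rewrite /up; lra.
have dnP z : [/\ dn z + 1 <= z, g (dn z) < z & dn z < g z].
  rewrite -(aut_lt (g^-1)%g (g _)) autK.
  split; rewrite /dn ?subrK ?ge_min ?lexx//; apply: (@lt_le_trans _ _ (dn z + 1)).
  - by rewrite /dn; lra.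
  - by rewrite /dn subrK !ge_min lexx !orbT.
  - by rewrite /dn; lra.
  - by rewrite /dn subrK !ge_min lexx !orbT.
exists x => -[k|[|k]].
- have -> : Posz k + 1 = Posz k.+1 by lia.
  exact: upP.
- exact: dnP.
- have -> : Negz k.+1 + 1 = Negz k by lia.
  exact: dnP.
Qed.

(* Every [g] is a product [u * v] where [u] fixes the odd and [v] the even terms
   of a sequence that grows fast enough. *)
Lemma small_homogeneous (H : set aut) : small H -> homogeneous H -> forall g, H g.
Proof.
move=> HH hom g; have [x xP] := fragmentation_sequence g.
have xub : forall y, (exists n, x (2 * n) <= y) /\ (exists n, y < x (2 * n)).
  apply: (@int_unbounded (fun n => x (2 * n))) => n.
  have [x1 _ _] := xP (2 * n); have [x2 _ _] := xP (2 * n + 1).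
  have -> : 2 * (n + 1) = 2 * n + 1 + 1 by lia.
  lra.
have even_odd n : x (2 * n) < x (2 * n + 1) < x (2 * (n + 1)).
  have [x1 _ _] := xP (2 * n); have [x2 _ _] := xP (2 * n + 1).
  have -> : 2 * (n + 1) = 2 * n + 1 + 1 by lia.
  by apply/andP; split; lra.
have geven n : g (x (2 * n)) < x (2 * n + 1) < g (x (2 * (n + 1))).
  have [_ x1 _] := xP (2 * n); have [_ _ x2] := xP (2 * n + 1).
  have -> : 2 * (n + 1) = 2 * n + 1 + 1 by lia.
  by rewrite x1.
have [y|y|p pE] := aut_interleave even_odd; [by case: (xub y)|by case: (xub y)|].
have [y|y|q qE] := aut_interleave geven.
- have [[n xn] _] := xub ((g^-1)%g y); exists n.
  by rewrite -(autKV g y) aut_le.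
- have [_ [n xn]] := xub ((g^-1)%g y); exists n.
  by rewrite -(autKV g y) aut_lt.
(* [p] takes the terms of [x] as values at the integers, and [q] the same terms with the even ones
   replaced by their images under [g]. *)
pose u := (q * p^-1)%g.
have u_even n : u (x (2 * n)) = g (x (2 * n)).
  by rewrite /u autM (autV_eq (pE n).1) (qE n).1.
have u_odd n : u (x (2 * n + 1)) = x (2 * n + 1).
  by rewrite /u autM (autV_eq (pE n).2) (qE n).2.
have -> : g = (u * (u^-1 * g))%g by rewrite mulgA mulgV mul1g.
apply: (smallM HH).
  apply: (small_fixing_sequence (x := fun n => x (2 * n + 1)) HH hom) => // [n|y|y].
  - have /andP[_ h1] := even_odd n; have /andP[h2 _] := even_odd (n + 1).
    exact: lt_trans h1 h2.
  - have [[n xn] _] := xub y; exists (n - 1).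
    have /andP[_ h1] := even_odd (n - 1); apply: le_trans (ltW h1) _.
    by rewrite subrK.
  - have [_ [n xn]] := xub y; exists n.
    have /andP[h1 _] := even_odd n; exact: lt_trans h1.
apply: (small_fixing_sequence (x := fun n => x (2 * n)) HH hom) => [n|y|y|n].
- by have /andP[h1 h2] := even_odd n; exact: lt_trans h1 h2.
- by case: (xub y).
- by case: (xub y).
- by rewrite autM -u_even autK.
Qed.

(* [None] stands for an infinite endpoint. *)
Definition below (q : option rat) (x : rat) : bool := if q is Some q' then x < q' else true.
Definition above (p : option rat) (x : rat) : bool := if p is Some p' then p' < x else true.
Definition in_comp (p q : option rat) (x : rat) : bool := above p x && below q x.

(** Two halves meet at a point [m] of the interval: each is a rescaled [squash] towards a finite
    endpoint and a translation towards an infinite one. *)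
Lemma comp_chart_exists (p q : option rat) :
  (if p is Some p' then below q p' else true) ->
  exists psi : rat -> rat, [/\ {homo psi : x y / x < y},
    forall z, in_comp p q (psi z) & forall x, in_comp p q x -> exists z, psi z = x].
Proof.
move=> pq; have [m /andP[pm mq]] : exists m, in_comp p q m.
  rewrite /in_comp; case: p q pq => [p|] [q|] /= pq.
  - by exists ((p + q) / 2); apply/andP; split; lra.
  - by exists (p + 1); apply/andP; split=> //; lra.
  - by exists (q - 1); lra.
  - by exists 0.
pose up z := if q is Some q' then m + (q' - m) * squash z else m + z.
pose dn z := if p is Some p' then m + (m - p') * squash z else m + z.
have uph : {homo up : x y / x < y}.
  move=> x y xy; rewrite /up; case: q pq mq {up} => [q|] _ /= mq; rewrite ltrD2l//.
  by rewrite ltr_pM2l ?subr_gt0// squash_lt.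
have dnh : {homo dn : x y / x < y}.
  move=> x y xy; rewrite /dn; case: p pq pm {dn} => [p|] _ /= pm; rewrite ltrD2l//.
  by rewrite ltr_pM2l ?subr_gt0// squash_lt.
have up0 : up 0 = m by rewrite /up; case: q {pq mq up uph} => [q|]; rewrite ?squash0 ?mulr0 addr0.
have dn0 : dn 0 = m by rewrite /dn; case: p {pq pm dn dnh} => [p|]; rewrite ?squash0 ?mulr0 addr0.
exists (fun z => if 0 <= z then up z else dn z); split.
- move=> x y xy; case: ifP => x0; case: ifP => y0.
  + exact: uph.
  + by move: y0; rewrite (le_trans x0 (ltW xy)).
  + move/negbT: x0; rewrite -ltNge => /dnh x0; apply: lt_le_trans x0 _.
    by rewrite dn0 -up0; move: y0; rewrite le_eqVlt => /orP[/eqP->//|/uph/ltW].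
  + exact: dnh.
- move=> z; case: ifP => z0; apply/andP; split.
  + have : m <= up z.
      by rewrite -up0; move: z0; rewrite le_eqVlt => /orP[/eqP->//|/uph/ltW].
    by rewrite /above; case: p pm {pq dn dnh dn0} => //= p; exact: lt_le_trans.
  + rewrite /up; case: q mq {pq up uph up0} => //= q mq; have := squash_bound z; nra.
  + rewrite /dn; case: p pm {pq dn dnh dn0} => //= p pm; have := squash_bound z; nra.
  + move/negbT: z0; rewrite -ltNge => /dnh; rewrite dn0 => zm.
    by rewrite /below; case: q mq {pq up uph up0} => //= q; exact: lt_trans.
- move=> x /andP[px xq]; have [mx|xm] := leP m x.
    have [z zx] : exists z, up z = x.
      rewrite /up; case: q mq xq {pq up uph up0} => [q|] /= mq xq; last first.
        by exists (x - m); rewrite addrC subrK.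
      have [|z zE] := @squash_onto ((x - m) / (q - m)).
        by rewrite ltr_pdivlMr ?ltr_pdivrMr ?subr_gt0//; apply/andP; split; lra.
      by exists z; rewrite zE; field; lra.
    exists z; rewrite ifT// leNgt; apply/negP => /uph.
    by rewrite zx up0 ltNge mx.
  have [z zx] : exists z, dn z = x.
    rewrite /dn; case: p pm px {pq dn dnh dn0} => [p|] /= pm px; last first.
      by exists (x - m); rewrite addrC subrK.
    have [|z zE] := @squash_onto ((x - m) / (m - p)).
      by rewrite ltr_pdivlMr ?ltr_pdivrMr ?subr_gt0//; apply/andP; split; lra.
    by exists z; rewrite zE; field; lra.
  exists z; rewrite ifF//; apply/negP; rewrite le_eqVlt => /orP[/eqP z0|/dnh].
    by move: xm; rewrite -zx -z0 dn0 ltxx.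
  by rewrite zx dn0 ltNge ltW.
Qed.

(** Density lets [H] carry any interval inside the component to any other, so the pullback of [H]
    along a chart of the component is homogeneous, hence everything. *)
Lemma small_comp (H : set aut) (F : seq rat) (p q : option rat) :
  small H ->
  (forall g : aut, {in F, g =1 id} ->
    forall E : seq rat, exists2 h, H h & {in E, h =1 g}) ->
  (forall f, f \in F -> ~~ in_comp p q f) ->
  forall g : aut, (forall x, ~~ in_comp p q x -> g x = x) -> H g.
Proof.
move=> HH dense Fpq g gN.
have [pq|npq] := boolP (if p is Some p' then below q p' else true); last first.
  suff -> : g = 1%g by exact: small1.
  apply: autP => x; apply: gN; apply/negP => /andP[px xq].
  case: p q npq px xq {Fpq} => [p|] [q|] //= pq px xq.
  by rewrite (lt_trans px xq) in pq.
have [psi [psih psiin psionto]] := comp_chart_exists pq.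
have chiP : chart_family (fun _ : unit => psi).
  split=> [_ x y|_ u v y|[] []//]; first exact: psih.
  move=> /andP[uy yv]; have /andP[pu _] := psiin u; have /andP[_ vq] := psiin v.
  apply: psionto; apply/andP; split.
    by case: (p) pu => //= p'; move/lt_trans; apply.
  by case: (q) vq => //= q'; exact: lt_trans.
have [tau0 [tauE tauN]] := chart_action chiP.
have tauM := chart_actionM tauE tauN.
pose tau k := tau0 (fun=> k).
have {}tauM : {morph tau : f g / (f * g)%g} by move=> f k; exact: tauM.
have {}tauE k z : tau k (psi z) = psi (k z) by exact: (tauE _ tt).
have {}tauN k x : ~~ in_comp p q x -> tau k x = x.
  by move=> nx; apply: tauN => _ u e; move: nx; rewrite -e psiin.
have psilt x y : (psi x < psi y) = (x < y) by exact: (chart_lt chiP tt).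
have psiinj : injective psi by exact: (chart_inj chiP (i := tt)).
have pull (k : aut) : (forall x, ~~ in_comp p q x -> k x = x) -> exists k', k = tau k'.
  move=> kN.
  have inv (k' : aut) : (forall x, ~~ in_comp p q x -> k' x = x) ->
      forall u, exists v, k' (psi u) = psi v.
    move=> k'N u; have [/psionto[v]|/k'N/aut_inj e] := boolP (in_comp p q (k' (psi u))).
      by exists v.
    by exists u.
  have kVN x : ~~ in_comp p q x -> (k^-1)%g x = x by move=> /kN; exact: autV_fix.
  have [k' k'E] := chart_pullback chiP (i := tt) (inv k kN) (inv _ kVN).
  exists k'; apply: autP => x; have [/psionto[z <-]|nx] := boolP (in_comp p q x).
    by rewrite k'E tauE.
  by rewrite kN// tauN.
have [k ->] := pull g gN.
apply: (small_homogeneous (small_preimage tauM HH)).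
move=> a b a' b' ab ab' Hab k' k'N /=.
have [k0 [k0a k0b]] := aut_affine ab ab'.
(* [h] matches [tau k0] only at the two endpoints, but conjugation by it already moves the support
   of [tau k'] between [psi a] and [psi b]. *)
have [|h Hh hE] := dense (tau k0) _ [:: psi a; psi b].
  by move=> f /Fpq; exact: tauN.
have ha : h (psi a) = psi a' by rewrite hE ?inE ?eqxx// tauE k0a.
have hb : h (psi b) = psi b' by rewrite hE ?inE ?eqxx ?orbT// tauE k0b.
have tN x : ~~ (psi a' < x < psi b') -> tau k' x = x.
  move=> nx; have [/psionto[z zx]|/tauN//] := boolP (in_comp p q x).
  by move: nx; rewrite -zx !psilt tauE => /k'N->.
have hN x : ~~ (psi a < x < psi b) -> (h^-1 * tau k' * h)%g x = x.
  by move=> nx; rewrite !autM tN ?autK// -ha -hb !aut_lt.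
have [|k1 k1E] := pull (h^-1 * tau k' * h)%g.
  move=> x nx; apply: hN; apply: contra nx => /andP[ax xb].
  by have [w <-] := chart_conv chiP (i := tt) (u := a) (v := b) (y := x) (introT andP (conj ax xb)).
have -> : tau k' = (h * (h^-1 * tau k' * h) * h^-1)%g.
  by apply: autP => x; rewrite !autM !autKV.
rewrite k1E; apply: (smallM HH); last exact: (smallV HH).
apply: (smallM HH) => //; apply: Hab => z zab.
by apply: psiinj; rewrite -tauE -k1E hN// !psilt.
Qed.

(** [g] is cut at the points of [F], one at a time, into factors supported in the components of the
    complement. The list [L] bounds the cuts still to be made. *)
Lemma small_index (H : set aut) : small H ->
  exists F : seq rat, forall g : aut, {in F, g =1 id} -> H g.
Proof.
move=> HH; have [F dense] := small_dense HH; exists F.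
suff key (L : seq rat) p q : (forall f, f \in F -> in_comp p q f -> f \in L) ->
    forall g : aut, (forall x, ~~ in_comp p q x -> g x = x) -> {in F, g =1 id} -> H g.
  by move=> g gF; apply: (key F None None).
elim: L p q => [|f L IH] p q FL g gN gF.
  by apply: (small_comp HH dense (p := p) (q := q)) => // f fF; apply/negP => /(FL _ fF).
have [/andP[fF fpq]|nf] := boolP ((f \in F) && in_comp p q f); last first.
  apply: (IH p q) => // x xF xpq; have := FL x xF xpq.
  rewrite inE => /orP[/eqP e|//]; by rewrite -e xF xpq in nf.
have [|h [k [gE hk1 hk2]]] := @aut_split g [set x | x < f].
  move=> x y /= xf /negP; rewrite -leNgt => fy.
  by exists f; [exact: gF|rewrite (ltW xf) fy].
have hF : {in F, h =1 id}.
  move=> x xF; have [/hk1[->]|/negP/hk2[]//] := boolP (x < f); first by rewrite gF.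
have kF : {in F, k =1 id}.
  move=> x xF; have [/hk1[]//|/negP/hk2[_ ->]] := boolP (x < f); by rewrite gF.
move: fpq => /andP[pf fq]; rewrite gE.
apply: (smallM HH).
  apply: (IH p (Some f)) => // [x xF /andP[px xf]|x].
    have : x \in f :: L.
      apply: FL => //; rewrite /in_comp px/=; case: (q) fq => //= q'; exact: lt_trans.
    by rewrite inE lt_eqF.
  rewrite negb_and; have [xf|xf _] := boolP (below (Some f) x).
    rewrite orbF => px; have [-> _] := hk1 _ xf; apply: gN.
    by rewrite negb_and px.
  by have /negP/hk2[] := xf.
apply: (IH (Some f) q) => // [x xF /andP[fx xq]|x].
  have : x \in f :: L.
    apply: FL => //; rewrite /in_comp xq andbT; case: (p) pf => //= p'.
    by move=> p'f; exact: lt_trans fx.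
  by rewrite inE gt_eqF.
rewrite negb_and; have [fx|xf _] := boolP (above (Some f) x).
  move=> xq; have [|_ ->] := hk2 x; first by rewrite /= => /(lt_trans fx); rewrite ltxx.
  by apply: gN; rewrite negb_and; apply/orP; right.
move: xf; rewrite /= -leNgt le_eqVlt => /orP[/eqP->|/hk1[]//].
exact: kF.
Qed.

(** * The embedding monoid and its topology *)

Lemma Tr_nbhs (X : choiceType) (f : Tr X) (A : set (Tr X)) : nbhs f A ->
  exists E : seq X, forall g : Tr X, {in E, g =1 f} -> A g.
Proof.
move=> fA; have [_ /(_ f)/(_ A fA)[U [[bc _ <-] bcf] UA]] := Tr_basis X.
exists (map fst bc) => g gE; apply: UA => p pbc.
by rewrite gE ?(bcf _ pbc)//; exact: map_f.
Qed.

Lemma Tr_nbhs_eq (X : choiceType) (f : Tr X) (E : seq X) :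
  open_nbhs f [set g : Tr X | {in E, g =1 f}].
Proof.
have -> : [set g : Tr X | {in E, g =1 f}] = Tr_basic [seq (x, f x) | x <- E].
  rewrite predeqE => g; split=> [gE _ /mapP[x xE ->]|gE x xE]; first exact: gE.
  by apply: (gE (x, f x)); apply/mapP; exists x.
split; first by have [+ _] := Tr_basis X; apply; exists [seq (x, f x) | x <- E].
by move=> _ /mapP[x _ ->].
Qed.

Lemma submonoid_continuous (X Y : choiceType) (M : submonoid (Tr X))
    (N : submonoid (Tr Y)) (F : M -> N) :
  (forall s y, exists E : seq X, forall s' : M, {in E, val s' =1 val s} ->
    val (F s') y = val (F s) y) -> continuous F.
Proof.
move=> Floc; apply/continuousP => _ [B oB <-].
rewrite openE => s /= FsB; rewrite /interior.
have [W WB] : exists W : seq Y, forall g : Tr Y, {in W, g =1 val (F s)} -> B g.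
  by apply: Tr_nbhs; exact: open_nbhs_nbhs.
have /choice[E EP] := Floc s.
have [oE sE] := Tr_nbhs_eq (val s) (flatten (map E W)).
rewrite nbhsE; exists (val @^-1` [set g : Tr X | {in flatten (map E W), g =1 val s}]).
  by split; [exists [set g : Tr X | {in flatten (map E W), g =1 val s}]|exact: sE].
move=> s' s'E; apply: WB => y yW; apply: EP => x xE; apply: s'E.
by apply/flatten_mapP; exists y.
Qed.

(** On three points betweenness forces a common direction; two arbitrary pairs are compared through
    a point [p] below both. *)
Lemma emb_betwE (f : rat -> rat) : emb_betw f ->
  {homo f : x y / x < y} \/ {homo f : x y /~ x < y}.
Proof.
move=> [finj fb].
have three x y z : x < y -> y < z ->
    ((f x < f y) = (f y < f z)) /\ ((f x < f y) = (f x < f z)).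
  move=> xy yz; have := fb x y z; rewrite /betw (ltW xy) (ltW yz) => /(_ isT).
  have xy' : f x != f y by rewrite (inj_eq finj) lt_eqF.
  have yz' : f y != f z by rewrite (inj_eq finj) lt_eqF.
  move=> /orP[/andP[]|/andP[]]; rewrite !le_eqVlt eq_sym.
    rewrite eq_sym (negbTE xy') (negbTE yz') /= => h1 h2.
    by rewrite h1 h2 (lt_trans h1 h2).
  rewrite (negbTE yz') eq_sym (negbTE xy')/= => h1 h2.
  by rewrite ltNge (ltW h2) ltNge (ltW h1) ltNge (ltW (lt_trans h1 h2)).
have same x y u v : x < y -> u < v -> (f x < f y) = (f u < f v).
  move=> xy uv; pose p := Num.min x u - 1.
  have px : p < x by have : Num.min x u <= x; [rewrite ge_min lexx|rewrite /p; lra].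
  have pu : p < u by have : Num.min x u <= u; [rewrite ge_min lexx orbT|rewrite /p; lra].
  have -> := esym (three _ _ _ px xy).1; have -> := esym (three _ _ _ pu uv).1.
  by have [xu|ux|->//] := ltgtP x u; [rewrite (three _ _ _ px xu).2|rewrite (three _ _ _ pu ux).2].
have [f01|f01] := boolP (f 0 < f 1).
  by left=> x y xy; rewrite (same x y 0 1).
right=> x y xy; have : ~~ (f y < f x) by rewrite (same y x 0 1) ?ltr01.
by rewrite -leNgt le_eqVlt (inj_eq finj) gt_eqF.
Qed.

Lemma emb_betw_homo (f : rat -> rat) : {homo f : x y / x < y} -> emb_betw f.
Proof.
move=> fh; have fle x y : x <= y -> f x <= f y.
  by rewrite le_eqVlt => /orP[/eqP->//|/fh/ltW].
split=> [x y e|x y z].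
  by case: (ltgtP x y) => // /fh; rewrite e ltxx.
by case/orP=> /andP[/fle h1 /fle h2]; rewrite /betw h1 h2 ?orbT.
Qed.

Lemma emb_betw_opp : emb_betw -%R.
Proof.
split; first exact: oppr_inj.
by move=> x y z; rewrite /betw !lerN2 orbC andbC [in X in _ || X]andbC.
Qed.

Definition homo_emb (f : rat -> rat) (fh : {homo f : x y / x < y}) : Emb_betw :=
  exist _ (f : Tr rat) (mem_set (emb_betw_homo fh)).

Definition opp_emb : Emb_betw := exist _ (-%R : Tr rat) (mem_set emb_betw_opp).

Definition aut_emb (g : aut) : Emb_betw := homo_emb (aut_mono g).

Lemma emb_val_inj (s t : Emb_betw) : val s =1 val t -> s = t.
Proof. by move=> st; apply: val_inj; apply/funext. Qed.

Lemma emb_valM (s t : Emb_betw) (x : rat) : val (s * t)%g x = val s (val t x).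
Proof. by []. Qed.

(** Both maps skip a piece above [c], where the image of [c] alone can be moved. Composing with the
    two maps detects by an inequation whether [c] is a value. *)
Lemma emb_differ_at (c : rat) : exists alpha beta : Emb_betw,
  val alpha c <> val beta c /\ forall x, val alpha x <> val beta x -> x = c.
Proof.
have ah : {homo (fun x : rat => if x <= c then x else x + 1) : x y / x < y}.
  by move=> x y xy; case: (leP x c); case: (leP y c); lra.
have bh : {homo (fun x : rat => if x < c then x else
    if x == c then c + 1 / 2 else x + 1) : x y / x < y}.
  by move=> x y xy; case: (ltgtP x c); case: (ltgtP y c); lra.
exists (homo_emb ah), (homo_emb bh); rewrite /= lexx ltxx eqxx; split; first lra.
by move=> x; case: (ltgtP x c).
Qed.

(** The range of [d1] is the open interval of radius 1 around [b]; the range of [d2] avoids it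
    except at [b]. *)
Lemma emb_meet_at (b : rat) : exists d1 d2 : Emb_betw,
  [/\ exists x, val d1 x = b, exists x, val d2 x = b &
    forall x y, val d1 x = val d2 y -> val d1 x = b].
Proof.
have h1 : {homo (fun x => b + squash x) : x y / x < y}.
  by move=> x y /squash_lt; rewrite ltrD2l.
have h2 : {homo (fun x : rat => if x < b then x - 1 else
    if x == b then b else x + 1) : x y / x < y}.
  by move=> x y xy; case: (ltgtP x b); case: (ltgtP y b); lra.
exists (homo_emb h1), (homo_emb h2); split=> /=.
- by exists 0; rewrite squash0 addr0.
- by exists b; rewrite ltxx eqxx.
- by move=> x y; have := squash_bound x; case: (ltgtP y b); lra.
Qed.

(** * Isomorphisms onto closed transformation monoids *)

Section Isomorphism.
Variables (Omega : countType) (N : submonoid (Tr Omega)) (theta : Emb_betw -> N).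
Hypothesis thetaM : forall s t, theta (s * t)%g = (theta s * theta t)%g.

Lemma thetaME (s t : Emb_betw) (w : Omega) :
  val (theta (s * t)%g) w = val (theta s) (val (theta t) w).
Proof. by rewrite thetaM. Qed.

(* [s b = c] holds iff [alpha * s * d <> beta * s * d] for two suitable [d],
   an open condition on the image of [s] under any injective morphism. *)
Lemma iso_inverse_local (s0 : Emb_betw) (b : rat) : injective theta ->
  exists W : seq Omega, forall s : Emb_betw,
    {in W, val (theta s) =1 val (theta s0)} -> val s b = val s0 b.
Proof.
move=> thinj; set c := val s0 b.
have [alpha [beta [abc abN]]] := emb_differ_at c.
have [d1 [d2 [[x1 d1b] [x2 d2b] dd]]] := emb_meet_at b.
have key (d : Emb_betw) (x : rat) : val d x = b -> exists w : Omega,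
    forall s : Emb_betw, val (theta s) w = val (theta s0) w ->
    exists y, val s (val d y) = c.
  move=> db; have neq : theta (alpha * (s0 * d))%g <> theta (beta * (s0 * d))%g.
    by move=> /thinj/(congr1 (fun f : Emb_betw => val f x)); rewrite !emb_valM db.
  have [w wN] : exists w, val (theta (alpha * (s0 * d))%g) w <>
      val (theta (beta * (s0 * d))%g) w.
    apply: contrapT => /forallNP h; apply: neq; apply: val_inj; apply/funext => w.
    by apply: contrapT; exact: h.
  exists (val (theta d) w) => s sw.
  (* If [s * d] misses [c], then [alpha] and [beta] agree after it. Only the value of [theta s0] at
     one point enters, so [s] may replace [s0]. *)
  apply: contrapT => /forallNP h; apply: wN.
  rewrite !thetaME -sw -!thetaME; congr (val (theta _) w).
  apply: emb_val_inj => y; apply: contrapT => /abN; exact: h.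
have [w1 w1P] := key _ _ d1b; have [w2 w2P] := key _ _ d2b.
exists [:: w1; w2] => s sW.
have [y1 y1E] := w1P s (sW w1 (mem_head _ _)).
have [|y2 y2E] := w2P s; first by apply: sW; rewrite !inE eqxx orbT.
have [sinj _] : emb_betw (val s) by apply: set_mem; exact: valP.
have /sinj d12 : val s (val d1 y1) = val s (val d2 y2) by rewrite y1E.
by rewrite -y1E (dd _ _ d12).
Qed.

Hypothesis theta1 : theta 1%g = 1%g.

Lemma aut_embM (f g : aut) : aut_emb (f * g)%g = (aut_emb f * aut_emb g)%g.
Proof. exact: emb_val_inj. Qed.

Lemma theta_aut1 (w : Omega) : val (theta (aut_emb 1%g)) w = w.
Proof.
have -> : aut_emb 1%g = 1%g by exact: emb_val_inj.
by rewrite theta1.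
Qed.

(** Cosets of the stabilizer correspond to points of the orbit of [w], which lies in the countable
    set [Omega]. *)
Lemma small_stabilizer (w : Omega) :
  small [set g : aut | val (theta (aut_emb g)) w = w].
Proof.
split=> [f g fw gw|f fw|].
- suff : val (theta (aut_emb (f * g)%g)) w = w by [].
  by rewrite aut_embM thetaME [val (theta (aut_emb g)) w]gw.
- suff : val (theta (aut_emb f^-1%g)) w = w by [].
  by rewrite -{1}[w]fw -thetaME -aut_embM mulVg theta_aut1.
exists (fun g => pickle (val (theta (aut_emb g)) w)) => f g /(pcan_inj pickleK) fg.
suff : val (theta (aut_emb (f^-1 * g)%g)) w = w by [].
by rewrite aut_embM thetaME -fg -thetaME -aut_embM mulVg theta_aut1.
Qed.

Lemma theta_aut_local (w : Omega) : exists F : seq rat, forall f g : aut,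
  {in F, f =1 g} -> val (theta (aut_emb f)) w = val (theta (aut_emb g)) w.
Proof.
have [F FP] := small_index (small_stabilizer w); exists F => f g fg.
have h : val (theta (aut_emb (f^-1 * g)%g)) w = w.
  by apply: FP => x xF; rewrite autM -fg// autK.
rewrite -[in LHS]h -thetaME -aut_embM; congr (val (theta (aut_emb _)) w).
by rewrite mulVKg.
Qed.

Lemma iso_continuous : closed (N : set (Tr Omega)) -> bijective theta ->
  continuous theta.
Proof.
move=> Ncl thbij; have /choice[F FP] := theta_aut_local.
have key (s : Emb_betw) (g : aut) (w : Omega) : {homo val s : x y / x < y} ->
    {in F w, g =1 val s} -> val (theta s) w = val (theta (aut_emb g)) w.
  move=> sh gs; have ext (E : seq rat) : exists k : aut, {in E, k =1 val s}.
    by apply: aut_extend => x y _ _; exact: sh.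
  have /choice[k kE] := fun w => ext (F w).
  pose t : Tr Omega := fun w => val (theta (aut_emb (k w))) w.
  have tE (l : aut) W : {in flatten (map F W), l =1 val s} ->
      {in W, val (theta (aut_emb l)) =1 t}.
    move=> ls v vW; apply: FP => x xv; rewrite kE// ls//.
    by apply/flatten_mapP; exists v.
  (* On any finite set [t] agrees with the image of one automorphism, so it is in the closure of
     [N]. *)
  have Nt : (N : set (Tr Omega)) t.
    apply: Ncl => B /Tr_nbhs[W WB]; have [l ls] := ext (flatten (map F W)).
    exists (val (theta (aut_emb l))); split; first by apply: set_mem; exact: valP.
    by apply: WB; exact: tE.
  have [thinv thK thinvK] := thbij.
  have [s0 s0E] : exists s0, val (theta s0) = t.
    by exists (thinv (exist _ t (mem_set Nt))); rewrite thinvK.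
  suff ss : s0 = s.
    rewrite -ss s0E; apply: FP => x xw; by rewrite kE// gs.
  apply: emb_val_inj => b.
  have [W WP] := iso_inverse_local s0 b (bij_inj thbij).
  (* Close to [s], [l] has an image close to [t = theta s0], so it agrees with [s0] at [b]; it also
     agrees there with [s]. *)
  have [l ls] := ext (b :: flatten (map F W)).
  have <- : val (aut_emb l) b = val s0 b.
    by apply: WP; rewrite s0E; apply: tE => x xW; apply: ls; rewrite inE xW orbT.
  exact: ls (mem_head _ _).
have up (s : Emb_betw) : val s 0 < val s 1 -> {homo val s : x y / x < y}.
  move=> s01; have /emb_betwE[//|sd] : emb_betw (val s) by apply: set_mem; exact: valP.
  by have := lt_trans s01 (sd 1 0 ltr01); rewrite ltxx.
have loc (s s' : Emb_betw) w : val s 0 < val s 1 ->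
    {in 0 :: 1 :: F w, val s' =1 val s} -> val (theta s') w = val (theta s) w.
  move=> s01 ss'; have [|g gs] := @aut_extend (val s) (F w).
    by move=> x y _ _; exact: up.
  have s'01 : val s' 0 < val s' 1 by rewrite !ss' ?inE ?eqxx ?orbT.
  rewrite (key s g)//; last exact: up.
  apply: key; first exact: up.
  by move=> x xw; rewrite gs// ss'// !inE xw !orbT.
(* The points 0 and 1 ensure that [s'] has the same direction as [s]. *)
apply: submonoid_continuous => s w; exists (0 :: 1 :: F w) => s' ss'.
have [s01|s10] := boolP (val s 0 < val s 1); first exact: loc.
have oppK (r : Emb_betw) : r = (opp_emb * (opp_emb * r))%g.
  by apply: emb_val_inj => x; rewrite !emb_valM; exact: (esym (opprK _)).
rewrite (oppK s) (oppK s') ![val (theta (opp_emb * (_ * _))%g) w]thetaME; congr (val _ _).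
have oppE (r : Emb_betw) x : val (opp_emb * r)%g x = - (val r x : rat) by [].
apply: loc => [|x xF]; rewrite !oppE; last by rewrite ss'.
have [sinj _] : emb_betw (val s) by apply: set_mem; exact: valP.
by rewrite ltrN2 lt_neqAle leNgt s10 andbT (inj_eq sinj).
Qed.

End Isomorphism.

Theorem theorem2p2 : automatic_homeomorphicity Emb_betw.
Proof.
move=> Omega N Ncl theta [[theta1 thetaM] thbij].
split; first exact: iso_continuous.
have [g gK Kg] := thbij; exists g; split=> //.
apply: submonoid_continuous => t b.
have [W WP] := iso_inverse_local thetaM (g t) b (bij_inj thbij).
by exists W => t' t't; apply: WP => w wW; rewrite !Kg t't.
Qed.
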